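(* Let $1<p,q<\infty$ satisfy $1/p+1/q\geq 1$. Let $X$ and $Y$ be Banach spaces with unconditional finite-dimensional Schauder decompositions $\{X_i\}_{i\in I}$ and $\{Y_j\}_{j\in J}$, respectively (the index sets $I$, $J$ being arbitrary), such that $\{X_i\}_{i\in I}$ has a disjoint lower $p$-estimate and $\{Y_j\}_{j\in J}$ has a disjoint lower $q$-estimate. If $X$ and $Y$ are weakly sequentially complete, then so is the projective tensor product $X\widehat{\otimes}_\pi Y$.
   Context: By a subspace of a Banach space we mean a norm closed linear subspace. A Banach space is weakly sequentially complete if every weakly Cauchy sequence in it is weakly convergent. An unconditional Schauder decomposition of a Banach space $X$ is a family $\{X_i\}_{i\in I}$ of subspaces of $X$ such that each $x\in X$ can be written in a unique way as $x=\sum_{i\in I} x_i$ with $x_i\in X_i$ for all $i\in I$ and the series unconditionally convergent. For each $i \in I$ there is the associated bounded projection $P_i$ from $X$ onto $X_i$, so that $x=\sum_{i\in I}P_i(x)$ for all $x \in X$; for $C\subseteq I$, $P_C(x):=\sum_{i\in C}P_i(x)$ defines a bounded projection. The decomposition is finite-dimensional if each $X_i$ is finite-dimensional. For $1<p<\infty$, an unconditional Schauder decomposition $\{X_i\}_{i\in I}$ of $X$ has a disjoint lower $p$-estimate if there is a constant $c>0$ such that, for every finite collection $C_1,\dots,C_r$ of pairwise disjoint finite subsets of $I$ and every $x\in X$, $\left(\sum_{k=1}^r \|P_{C_k}(x)\|^p\right)^{1/p} \leq c \|x\|$. $\widehat{\otimes}_\pi$ denotes the projective tensor product of Banach spaces.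 *)

(* Defs.v *)
From HB Require Import structures.
From mathcomp Require Import all_boot all_order all_algebra finmap.
From mathcomp Require Import complex.
From mathcomp Require Import all_classical all_reals all_analysis.
From mathcomp Require Import showcase.summability.
Import Order.TTheory GRing.Theory Num.Theory.
Import numFieldNormedType.Exports.

Set Implicit Arguments.
Unset Strict Implicit.
Unset Printing Implicit Defensive.

Local Open Scope classical_set_scope.
Local Open Scope ring_scope.

(* Banach spaces are real or complex; in MathComp-Analysis a norm takes its
   values in the scalar field, so [rnorm] reads it back as a real number. *)
Variant scalars := RealScalars | ComplexScalars.

Definition scalar_field (R : realType) (F : scalars) : numFieldType :=
  match F with RealScalars => R | ComplexScalars => R[i] end.

Definition scalar_re (R : realType) (F : scalars) : scalar_field R F -> R :=
  match F return scalar_field R F -> R with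
  | RealScalars => id
  | ComplexScalars => @complex.Re R
  end.

Definition rnorm (R : realType) (F : scalars)
    (V : normedModType (scalar_field R F)) (x : V) : R :=
  scalar_re `|x|.

Section WeakSequentialCompleteness.
Variables (K : numFieldType) (V : normedModType K).

Definition weakly_cauchy (u : nat -> V) : Prop :=
  forall f : {linear V -> K^o}, continuous f -> cauchy (f (u n) @[n --> \oo]).

Definition weakly_converges (u : nat -> V) (x : V) : Prop :=
  forall f : {linear V -> K^o}, continuous f -> f (u n) @[n --> \oo] --> f x.

Definition weakly_sequentially_complete : Prop :=
  forall u : nat -> V, weakly_cauchy u -> exists x : V, weakly_converges u x.

End WeakSequentialCompleteness.

Section SchauderDecompositions.
Variables (K : numFieldType) (V : normedModType K) (I : choiceType).
Implicit Types (A : set V) (Vs : I -> set V) (C : {fset I}).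

Definition closed_subspace A : Prop := closed A /\ submod_closed [in A].

Definition finite_dimensional A : Prop :=
  exists (n : nat) (e : 'I_n -> V),
    A `<=` [set \sum_(k < n) a k *: e k | a in [set: 'I_n -> K]].

(* Unconditional convergence of a family indexed by an arbitrary set is
   convergence of the net of its finite partial sums. *)
Definition unconditional_sum (v : I -> V) (x : V) : Prop :=
  (fun C : {fset I} => \sum_(i <- C) v i) @ totally --> x.

Definition expansion Vs (x : V) (v : I -> V) : Prop :=
  (forall i, Vs i (v i)) /\ unconditional_sum v x.

Definition unconditional_schauder_decomposition Vs : Prop :=
  (forall i, closed_subspace (Vs i)) /\
  (forall x, exists! v : I -> V, expansion Vs x v).

Definition unconditional_fdd Vs : Prop :=
  unconditional_schauder_decomposition Vs /\
  (forall i, finite_dimensional (Vs i)).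

Definition decomp_proj Vs (i : I) (x : V) : V :=
  xget (fun=> 0) [set v | expansion Vs x v] i.

Definition decomp_fproj Vs C (x : V) : V :=
  \sum_(i <- C) decomp_proj Vs i x.

End SchauderDecompositions.

Definition disjoint_lower_estimate (R : realType) (F : scalars)
    (V : normedModType (scalar_field R F)) (I : choiceType)
    (Vs : I -> set V) (p : R) : Prop :=
  exists2 c : R, 0 < c &
    forall (r : nat) (C : 'I_r -> {fset I}),
      (forall k l, k != l -> [disjoint C k & C l]%fset) ->
      forall x : V,
        (\sum_(k < r) rnorm (decomp_fproj Vs (C k) x) `^ p) `^ p^-1
          <= c * rnorm x.

Section ProjectiveTensorProduct.
Variables (R : realType) (F : scalars).
Variables X Y : normedModType (scalar_field R F).

(* A finite sequence of pairs (x, y) stands for the sum of the elementary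
   tensors x (x) y; two of them are the same element of the algebraic tensor
   product when no bilinear form separates them. *)
Definition same_tensor (s s' : seq (X * Y)) : Prop :=
  forall b : {bilinear X -> Y -> (scalar_field R F)^o},
    \sum_(z <- s) b z.1 z.2 = \sum_(z <- s') b z.1 z.2.

Definition projective_norm (s : seq (X * Y)) : R :=
  inf [set \sum_(z <- s') rnorm z.1 * rnorm z.2 | s' in same_tensor s].

(* (Z, t) is a completion of the algebraic tensor product of X and Y under the
   projective norm, t x y being the image of x (x) y; this determines (Z, t)
   up to a unique isometric isomorphism. *)
Definition is_projective_tensor_product
    (Z : completeNormedModType (scalar_field R F))
    (t : {bilinear X -> Y -> Z}) : Prop :=
  (forall s : seq (X * Y),
     rnorm (\sum_(z <- s) t z.1 z.2) = projective_norm s) /\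
  dense [set \sum_(z <- s) t z.1 z.2 | s in [set: seq (X * Y)]].

End ProjectiveTensorProduct.

(* Main.v *)
Require Import Defs.
From HB Require Import structures.
From mathcomp Require Import all_boot all_order all_algebra finmap.
From mathcomp Require Import complex.
From mathcomp Require Import all_classical all_reals all_analysis.
From mathcomp Require Import showcase.summability.
From mathcomp Require Import ring lra.
Import Order.TTheory GRing.Theory Num.Theory.
Import numFieldNormedType.Exports.

(** Write P_C and Q_D for the projections of the two decompositions onto finite
    sets of indices, and u_n for a weakly Cauchy sequence in the tensor
    product. The identity splits as

      1 = P_C (x) 1 + (1 - P_C) (x) Q_D + (1 - P_C) (x) (1 - Q_D).

    The first two summands send u_n to weakly convergent sequences: one of the
    two factors has finite rank, so that the operator is a finite sum of
    operators that factor through Y, respectively X, and these spaces are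
    weakly sequentially complete ([finite_rank_tensor_weak]). Hence all depends
    on the third summand, the corner. If it is small on the tail of u_n for
    suitable C and D ([corner_small]), then u_n is, up to arbitrarily small
    errors, weakly convergent, and therefore weakly convergent
    ([weakly_converges_approx]).

    The lower estimates make the corner small. For disjoint sets A_k and
    disjoint sets B_k, Hoelder's inequality and 1/p + 1/q >= 1 give

      sum_k |P_(A_k) x| |Q_(B_k) y| <= M |x| |y|

    ([disjoint_blocks_sum_le]). The projective norm is the least cost of a
    representation by elementary tensors, so this extends to

      sum_k |(P_(A_k) (x) Q_(B_k)) z| <= M |z|

    for all z ([tensor_map_l1]): the diagonal blocks form a bounded operator
    into an l1-sum. If the corners did not become small, successive truncations
    of them would provide disjoint blocks and indices n_k >= k for which
    (P_(A_k) (x) Q_(B_k)) u_(n_k) stays away from 0. A gliding hump argument, in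
    the manner of Schur's theorem on l1, excludes this ([l1_schur]).

    The arguments rest on the Hahn-Banach theorem, for real and complex
    scalars ([norming_functional]), and on the universal property of the
    projective tensor product ([tensor_lift]), both proved here. *)

Set Implicit Arguments.
Unset Strict Implicit.
Unset Printing Implicit Defensive.

Local Open Scope classical_set_scope.
Local Open Scope ring_scope.

#[local] Existing Instance totally_filter.

(** * Real-valued norms *)

Section Scalars.
Variables (R : realType) (F : scalars).
Local Notation K := (scalar_field R F).

(** Norms are elements of the scalar field; [emb] identifies them with real
    numbers, so that all estimates below can be made in [R] for both kinds of
    scalars at once. *)
Definition emb : R -> K :=
  match F return R -> scalar_field R F with
  | RealScalars => id
  | ComplexScalars => real_complex R
  end.

Lemma embD a b : emb (a + b) = emb a + emb b.
Proof. by rewrite /emb; case: F => //; rewrite rmorphD. Qed.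
Lemma embN a : emb (- a) = - emb a.
Proof. by rewrite /emb; case: F => //; rewrite rmorphN. Qed.
Lemma embM a b : emb (a * b) = emb a * emb b.
Proof. by rewrite /emb; case: F => //; rewrite rmorphM. Qed.
Lemma emb1 : emb 1 = 1.
Proof. by rewrite /emb; case: F. Qed.
Lemma emb0 : emb 0 = 0.
Proof. by rewrite /emb; case: F. Qed.
Lemma emb_le a b : (emb a <= emb b) = (a <= b).
Proof. by rewrite /emb; case: F => //; rewrite lecR. Qed.
Lemma emb_lt a b : (emb a < emb b) = (a < b).
Proof. by rewrite /emb; case: F => //; rewrite ltcR. Qed.
Lemma emb_norm a : `|emb a| = emb `|a|.
Proof.
rewrite /emb; case: F => //=; rewrite normc_def /= expr0n /= addr0 sqrtr_sqr.
by [].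
Qed.
Lemma scalar_re_emb a : scalar_re (emb a) = a.
Proof. by rewrite /emb /scalar_re; case: F. Qed.

Lemma emb_re (k : K) : 0 <= k -> emb (scalar_re k) = k.
Proof.
move: k; rewrite /emb /scalar_re; case: F => //= -[a b].
by rewrite lecE /= => /andP[/eqP -> _].
Qed.

Section Rnorm.
Variable V : normedModType K.
Implicit Types x y : V.

Lemma embE x : `|x| = emb (rnorm x).
Proof. by rewrite /rnorm emb_re. Qed.

Lemma rnorm_ge0 x : 0 <= rnorm x.
Proof. by rewrite -emb_le -embE emb0. Qed.

Lemma rnormD x y : rnorm (x + y) <= rnorm x + rnorm y.
Proof. by rewrite -emb_le embD -!embE ler_normD. Qed.

Lemma rnormN x : rnorm (- x) = rnorm x.
Proof. by rewrite /rnorm normrN. Qed.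

Lemma rnormB x y : rnorm (x - y) <= rnorm x + rnorm y.
Proof. by rewrite -(rnormN y) rnormD. Qed.

Lemma rnormC x y : rnorm (x - y) = rnorm (y - x).
Proof. by rewrite -rnormN opprB. Qed.

Lemma rnorm0 : rnorm (0 : V) = 0.
Proof. by rewrite /rnorm normr0 -emb0 scalar_re_emb. Qed.

Lemma rnorm0_eq0 x : rnorm x = 0 -> x = 0.
Proof. by move=> h; apply: normr0_eq0; rewrite embE h emb0. Qed.

Lemma rnorm_sum (T : Type) (s : seq T) (f : T -> V) :
  rnorm (\sum_(i <- s) f i) <= \sum_(i <- s) rnorm (f i).
Proof.
elim/big_ind2 : _ => [|x a y b xa yb|//]; first by rewrite rnorm0.
exact: le_trans (rnormD _ _) (lerD _ _).
Qed.

End Rnorm.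

Section RnormScale.
Variable V : normedModType K.
Implicit Types x y : V.

Lemma rnormZ (a : K) x : rnorm (a *: x) = rnorm (a : K^o) * rnorm x.
Proof.
have emb_inj := @can_inj _ _ emb (@scalar_re R F) scalar_re_emb.
by apply: emb_inj; rewrite embM -(embE x) -embE -(embE (a : K^o)) normrZ.
Qed.

Lemma rnorm_embZ (a : R) x : rnorm (emb a *: x) = `|a| * rnorm x.
Proof.
by rewrite rnormZ; congr (_ * _); rewrite /rnorm /= emb_norm scalar_re_emb.
Qed.

Lemma cvg_rnormP (T : Type) (G : set_system T) (FG : Filter G) (f : T -> V) x :
  f @ G --> x <-> forall e : R, 0 < e -> \forall t \near G, rnorm (x - f t) <= e.
Proof.
split=> [/cvgrPdist_le h e e0|h].
  have /h : 0 < emb e by rewrite -emb0 emb_lt.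
  by apply: filterS => t; rewrite embE emb_le.
apply/cvgrPdist_le => e e0.
have h0 : 0 < scalar_re e by rewrite -emb_lt emb_re ?emb0// ltW.
apply: filterS (h _ h0) => t; rewrite embE -emb_le => /le_trans; apply.
by rewrite emb_re// ltW.
Qed.

Lemma cauchy_rnormP (u : nat -> V) :
  cauchy (u n @[n --> \oo]) <->
  forall e : R, 0 < e -> exists N, forall m n, (N <= m)%N -> (N <= n)%N ->
    rnorm (u m - u n) <= e.
Proof.
split=> [/cauchy_ballP h e e0|h].
  have /h [[A B] /= [[N _ NA] [N' _ NB]] AB] : 0 < emb e by rewrite -emb0 emb_lt.
  exists (maxn N N') => m n; rewrite !geq_max => /andP[m1 m2] /andP[n1 n2].
  have /AB : (A `*` B) (u m, u n) by split; [apply: NA|apply: NB].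
  by rewrite /= -ball_normE /= embE emb_lt => /ltW.
apply/cauchy_ballP => e e0.
have h0 : 0 < scalar_re e by rewrite -emb_lt emb_re ?emb0// ltW.
have [|N HN] := h (scalar_re e / 2); first by rewrite divr_gt0.
exists ([set x | exists2 n, (N <= n)%N & x = u n],
        [set x | exists2 n, (N <= n)%N & x = u n]) => /=.
  by split; exists N => // n /= Nn; exists n.
move=> [a b] /= [[m Nm ->] [n Nn ->]].
rewrite -ball_normE /= embE -[X in _ < X]emb_re ?ltW// emb_lt.
by apply: le_lt_trans (HN _ _ Nm Nn) _; rewrite ltr_pdivrMr// ltr_pMr// ltr1n.
Qed.

End RnormScale.
End Scalars.

(** * The Hahn-Banach theorem *)

Section HahnBanach.
Variables (R : realType) (F : scalars).
Local Notation K := (scalar_field R F).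
Variable V : normedModType K.
Implicit Types (x y z : V) (p : V -> R).
Local Notation "r '**' x" := (emb F r *: x) (at level 40).

Definition sublinear p : Prop :=
  (forall x y, p (x + y) <= p x + p y) /\
  (forall r x, 0 <= r -> p (r ** x) <= r * p x).

Lemma sublinear0 p : sublinear p -> p 0 = 0.
Proof.
move=> [pD pZ]; apply/eqP; rewrite eq_le; apply/andP; split.
  by have := pZ 0 0 (lexx _); rewrite scaler0 mul0r.
by have := pD 0 0; rewrite addr0; lra.
Qed.

Lemma sublinear_ge p x : sublinear p -> - p (- x) <= p x.
Proof.
move=> sp; have := sp.1 x (- x); rewrite subrr (sublinear0 sp); lra.
Qed.

(** This is the largest sublinear functional [q] below [p] with
    [q (- y) <= - p y]: subadditivity gives [q x <= q (x + t y) + t q (- y)]. *)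
Definition lower_along p y x : R :=
  inf [set p (x + t ** y) - t * p y | t in [set t : R | 0 <= t]].

Lemma sublinearZ p r x : sublinear p -> 0 <= r -> p (r ** x) = r * p x.
Proof.
move=> sp; rewrite le_eqVlt => /predU1P[<-|r0].
  by rewrite emb0 scale0r mul0r sublinear0.
apply/eqP; rewrite eq_le (sp.2 _ _ (ltW r0)) /=.
have := sp.2 r^-1 (r ** x); rewrite scalerA -embM mulVf ?gt_eqF// emb1 scale1r.
by rewrite invr_ge0 ltW// => /(_ isT); rewrite ler_pdivlMl.
Qed.

Section LowerAlong.
Variables (p : V -> R) (y : V).
Hypothesis sp : sublinear p.

Let lower_along_lbound x :
  lbound [set p (x + t ** y) - t * p y | t in [set t : R | 0 <= t]] (- p (- x)).
Proof.
move=> _ [t /= t0 <-]; have := sp.1 (x + t ** y) (- x).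
by rewrite addrAC subrr add0r sublinearZ//; lra.
Qed.

Lemma lower_along_le t x : 0 <= t -> lower_along p y x <= p (x + t ** y) - t * p y.
Proof.
move=> t0; apply: ge_inf; last by exists t.
by exists (- p (- x)); exact: lower_along_lbound.
Qed.

Lemma le_lower_along c x :
  (forall t, 0 <= t -> c <= p (x + t ** y) - t * p y) -> c <= lower_along p y x.
Proof.
move=> h; apply: lb_le_inf; first by exists (p (x + 0 ** y) - 0 * p y); exists 0 => /=.
by move=> _ [t /= t0 <-]; exact: h.
Qed.

Lemma lower_along_below x : lower_along p y x <= p x.
Proof.
by have := lower_along_le x (lexx 0); rewrite emb0 scale0r addr0 mul0r subr0.
Qed.

Lemma sublinear_lower_along : sublinear (lower_along p y).
Proof.
split=> [x x'|r x].
  rewrite -lerBlDr; apply: le_lower_along => t t0.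
  rewrite lerBlDr -lerBlDl; apply: le_lower_along => t' t'0.
  have := @lower_along_le (t + t') (x + x') (addr_ge0 t0 t'0).
  have := sp.1 (x + t ** y) (x' + t' ** y).
  rewrite addrACA -scalerDl -embD; lra.
rewrite le_eqVlt => /predU1P[<-|r0].
  rewrite emb0 scale0r mul0r (le_trans (lower_along_below _))//.
  by rewrite (sublinear0 sp).
rewrite -ler_pdivrMl//; apply: le_lower_along => t t0.
rewrite ler_pdivrMl//; have := @lower_along_le (r * t) (r ** x) (mulr_ge0 (ltW r0) t0).
rewrite embM -scalerA -scalerDr (sublinearZ _ sp (ltW r0)); lra.
Qed.

End LowerAlong.

(** Zorn's lemma applies because the infimum of a chain stays subadditive: of
    the two members that nearly attain the infimum at [x] and at [y], the
    smaller one serves at both points. *)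
Lemma minimal_sublinear p0 : sublinear p0 ->
  exists p, [/\ sublinear p, forall x, p x <= p0 x &
    forall q, sublinear q -> (forall x, q x <= p x) -> forall x, p x <= q x].
Proof.
move=> sp0.
pose T := {p : V -> R | sublinear p /\ forall x, p x <= p0 x}.
pose leT (a b : T) := `[< forall x, sval b x <= sval a x >].
have [||A Atot|[p [sp pp0]] pmax] :=
  @ZL_preorder T (exist _ p0 (conj sp0 (fun=> lexx _))) leT.
- by move=> a; apply/asboolP.
- move=> b a c /asboolP ba /asboolP ac; apply/asboolP => x.
  exact: le_trans (ac x) (ba x).
- have [[a0 Aa0]|A0] := pselect (exists a, A a); last first.
    exists (exist _ p0 (conj sp0 (fun=> lexx _))) => s As.
    by case: A0; exists s.
  pose m x := inf [set sval a x | a in A].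
  have lbm x : lbound [set sval a x | a in A] (- p0 (- x)).
    move=> _ [[a [sa ap0]] /= Aa <-].
    by have := sublinear_ge x sa; have := ap0 (- x); lra.
  have m_le a x : A a -> m x <= sval a x.
    by move=> Aa; apply: ge_inf; [exists (- p0 (- x))|exists a].
  have le_m c x : (forall a, A a -> c <= sval a x) -> c <= m x.
    move=> h; apply: lb_le_inf; first by exists (sval a0 x); exists a0.
    by move=> _ [a Aa <-]; exact: h.
  have sm : sublinear m.
    split=> [x y|r x].
      rewrite -lerBlDr; apply: (le_m) => a Aa.
      rewrite lerBlDr -lerBlDl; apply: (le_m) => b Ab; rewrite lerBlDl.
      have [ab|ba] : leT a b \/ leT b a by exact: Atot.
        apply: le_trans (m_le _ _ Ab) _; apply: le_trans ((svalP b).1.1 x y) _.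
        by rewrite lerD2r; move/asboolP: ab; exact.
      apply: le_trans (m_le _ _ Aa) _; apply: le_trans ((svalP a).1.1 x y) _.
      by rewrite lerD2l; move/asboolP: ba; exact.
    rewrite le_eqVlt => /predU1P[<-|r0].
      rewrite emb0 scale0r mul0r (le_trans (m_le _ _ Aa0))//.
      by rewrite (sublinear0 (svalP a0).1).
    rewrite -ler_pdivrMl//; apply: (le_m) => a Aa; rewrite ler_pdivrMl//.
    apply: le_trans (m_le _ _ Aa) _; exact: (svalP a).1.2 (ltW r0).
  have mp0 x : m x <= p0 x by apply: le_trans (m_le _ _ Aa0) ((svalP a0).2 x).
  by exists (exist _ m (conj sm mp0)) => s As; apply/asboolP => x; exact: m_le.
exists p; split=> // q sq qp x.
have qp0 z : q z <= p0 z by exact: le_trans (qp z) (pp0 z).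
by have /asboolP := pmax (exist _ q (conj sq qp0)) (asboolT qp).
Qed.

Lemma sublinear_rnorm : sublinear (@rnorm R F V).
Proof.
split=> [x y|r x r0]; first exact: rnormD.
by rewrite rnorm_embZ ger0_norm.
Qed.

(** A minimal sublinear functional [g] coincides with its lowering along any
    [y], which means [g x <= g (x + y) - g y]; so [g] is additive. Taking [g]
    minimal below the norm lowered along [z] forces [g (- z) <= - |z|]. *)
Lemma real_norming_functional z : exists g : V -> R,
  [/\ forall x y, g (x + y) = g x + g y,
      forall r x, g (r ** x) = r * g x,
      forall x, g x <= rnorm x & g z = rnorm z].
Proof.
have sn := sublinear_lower_along z sublinear_rnorm.
have [g [sg gle gmin]] := minimal_sublinear sn.
have gD x y : g (x + y) = g x + g y.
  apply/eqP; rewrite eq_le sg.1 /=.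
  have := gmin _ (sublinear_lower_along y sg) (lower_along_below y sg) x.
  have := lower_along_le y sg x ler01.
  rewrite emb1 scale1r mul1r; lra.
have gN x : g (- x) = - g x.
  by have := gD x (- x); rewrite subrr (sublinear0 sg); lra.
have gn x : g x <= rnorm x.
  exact: le_trans (gle x) (lower_along_below z sublinear_rnorm x).
exists g; split=> // [r x|].
  have [r0|r0] := leP 0 r; first exact: sublinearZ.
  rewrite -[r]opprK embN scaleNr gN sublinearZ ?oppr_ge0 ?ltW//.
  by rewrite !mulNr.
apply/eqP; rewrite eq_le gn /=.
have := gle (- z); have := lower_along_le z sublinear_rnorm (- z) ler01.
rewrite emb1 scale1r mul1r addNr rnorm0 gN; lra.
Qed.

End HahnBanach.

Local Notation KC R := (scalar_field R ComplexScalars)^o.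

(** Over the complex numbers, [f x = g x - i g (i x)] is complex linear when
    [g] is real linear, and it is dominated by the norm: multiplied by a scalar
    of modulus 1, [x] has a positive image under [f], which is then the value
    of [g]. *)
Lemma norming_functional (R : realType) (F : scalars)
    (V : normedModType (scalar_field R F)) (z : V) :
  exists f : V -> (scalar_field R F)^o,
    [/\ linear f, forall x, rnorm (f x) <= rnorm x & rnorm (f z) = rnorm z].
Proof.
case: F V z => V z; have [g [gD gZ gn gz]] := real_norming_functional z.
  have gN x : g (- x) = - g x.
    by have := gZ (-1) x; rewrite embN emb1 scaleN1r mulN1r.
  exists g; split=> [a x y|x|]; first by rewrite gD; congr (_ + _); exact: gZ.
    suff : `|g x| <= rnorm x by [].
    by rewrite ler_norml gn andbT lerNl -gN -(rnormN x) gn.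
  suff : `|g z| = rnorm z by [].
  by rewrite gz ger0_norm ?rnorm_ge0.
pose i : R[i] := 'i%C.
pose f (x : V) : R[i] := ((g x) +i* (- g (i *: x)))%C.
have gN x : g (- x) = - g x.
  by have := gZ (-1) x; rewrite embN emb1 scaleN1r mulN1r.
have gZC r x : g ((r%:C)%C *: x) = r * g x := gZ r x.
have fl : linear (f : V -> KC R).
  move=> [a b] x y.
  have gab x' : g ((a +i* b)%C *: x') = a * g x' + b * g (i *: x').
    rewrite [X in X *: _]complexE scalerDl gD /= (mulrC _ (b%:C)%C) -scalerA.
    by rewrite !gZC.
  have gi x' : g (i *: (i *: x')) = - g x'.
    by rewrite scalerA -expr2 sqr_i scaleN1r gN.
  rewrite /f scalerDr !gD scalerA (mulrC i) -scalerA !gab gi.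
  apply/eqP; rewrite eq_complex /=; apply/andP; split; apply/eqP; ring.
have f0 : f 0 = 0.
  have g0 : g 0 = 0 by have := gN 0; rewrite oppr0; lra.
  by rewrite /f scaler0 g0 oppr0.
have fZ u x : f (u *: x) = u * f x.
  by have := fl u x 0; rewrite !addr0 f0 addr0.
have Re_le (k : R[i]) : complex.Re k <= rnorm (k : KC R).
  have := normc_ge_Re k; rewrite -(@emb_re R ComplexScalars (Num.norm k))// lecR.
  by apply: le_trans; exact: ler_norm.
have fn x : rnorm (f x : KC R) <= rnorm x.
  have [fx0|fx0] := eqVneq (f x) 0.
    by rewrite (_ : f x = 0 :> KC R)// rnorm0 rnorm_ge0.
  pose u : R[i] := `|f x| / f x.
  have fu : f (u *: x) = `|f x| by rewrite fZ /u divfK.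
  have nu : rnorm (u : KC R) = 1.
    by rewrite /rnorm /u normrM normfV normr_id divff// normr_eq0.
  apply: le_trans (_ : complex.Re (f (u *: x)) <= _); first by rewrite fu.
  by apply: le_trans (gn (u *: x)) _; rewrite (@rnormZ R ComplexScalars V) nu mul1r.
exists f; split=> //; apply/eqP; rewrite eq_le fn /=.
by rewrite -[leLHS]gz; exact: Re_le (f z).
Qed.

(** * Bounded linear maps and weak limits *)

Lemma inv_succ_small (R : realType) (e : R) : 0 < e ->
  exists N, forall k, (N <= k)%N -> k.+1%:R^-1 <= e.
Proof.
move=> e0; exists (Num.truncn e^-1) => k Nk; rewrite invf_ple ?posrE//.
by apply: (le_trans (ltW (truncnS_gt _))); rewrite ler_nat ltnS.
Qed.

Section BoundedLinear.
Variables (R : realType) (F : scalars).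
Local Notation K := (scalar_field R F).
Implicit Types V W : normedModType K.

Definition bounded_linear V W (M : R) (f : V -> W) : Prop :=
  linear f /\ forall x, rnorm (f x) <= M * rnorm x.

Definition seq_cauchy V (u : nat -> V) : Prop :=
  forall e : R, 0 < e -> exists N, forall m n, (N <= m)%N -> (N <= n)%N ->
    rnorm (u m - u n) <= e.

Definition seq_lim V (u : nat -> V) (x : V) : Prop :=
  forall e : R, 0 < e -> exists N, forall n, (N <= n)%N -> rnorm (x - u n) <= e.

Section Linear.
Variables (V W : normedModType K) (f : V -> W).
Hypothesis fl : linear f.

Lemma lin0 : f 0 = 0.
Proof. by have := fl (-1) 0 0; rewrite !scaleN1r addNr addNr. Qed.
Lemma linD x y : f (x + y) = f x + f y.
Proof. by have := fl 1 x y; rewrite !scale1r. Qed.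
Lemma linZ a x : f (a *: x) = a *: f x.
Proof. by have := fl a x 0; rewrite lin0 !addr0. Qed.
Lemma linN x : f (- x) = - f x.
Proof. by rewrite -scaleN1r linZ scaleN1r. Qed.
Lemma linB x y : f (x - y) = f x - f y.
Proof. by rewrite linD linN. Qed.
Lemma lin_sum (T : Type) (s : seq T) (g : T -> V) :
  f (\sum_(i <- s) g i) = \sum_(i <- s) f (g i).
Proof. exact: (big_morph f linD lin0). Qed.
End Linear.

Lemma bounded_linearW V W M M' (f : V -> W) :
  M <= M' -> bounded_linear M f -> bounded_linear M' f.
Proof.
move=> MM' [fl fM]; split=> // x; apply: le_trans (fM x) _.
by rewrite ler_wpM2r ?rnorm_ge0.
Qed.

Lemma bounded_linear_id V : bounded_linear 1 (@id V).
Proof. by split=> // x; rewrite mul1r. Qed.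

Lemma bounded_linear_comp (U V W : normedModType K) M N (g : V -> W) (f : U -> V) :
  0 <= N -> bounded_linear N g -> bounded_linear M f ->
  bounded_linear (N * M) (fun x => g (f x)).
Proof.
move=> N0 [gl gN] [fl fM]; split=> [a x y|x]; first by rewrite fl gl.
by apply: le_trans (gN _) _; rewrite -mulrA ler_wpM2l.
Qed.

Lemma bounded_linearD V W M N (f g : V -> W) :
  bounded_linear M f -> bounded_linear N g ->
  bounded_linear (M + N) (fun x => f x + g x).
Proof.
move=> [fl fM] [gl gN]; split=> [a x y|x].
  by rewrite fl gl scalerDr addrACA.
by apply: le_trans (rnormD _ _) _; rewrite mulrDl lerD.
Qed.

Lemma bounded_linearB V W M N (f g : V -> W) :
  bounded_linear M f -> bounded_linear N g ->
  bounded_linear (M + N) (fun x => f x - g x).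
Proof.
move=> [fl fM] [gl gN]; split=> [a x y|x].
  by rewrite fl gl scalerBr opprD addrACA.
by apply: le_trans (rnormB _ _) _; rewrite mulrDl lerD.
Qed.

Lemma exists_linear V W (f : V -> W) : linear f ->
  exists g : {linear V -> W}, g =1 f.
Proof.
move=> fl.
pose g : {linear V -> W} := HB.pack f (GRing.isLinear.Build _ _ _ _ f fl).
by exists g.
Qed.

Lemma bounded_linear_is_continuous V W M (f : {linear V -> W}) :
  bounded_linear M f -> continuous f.
Proof.
move=> [_ fM]; refine (@bounded_linear_continuous _ _ _ f _).
apply/bounded_funP => r.
exists (emb F (Num.max M 0) * r) => x xr.
rewrite embE (le_trans (_ : _ <= emb F (Num.max M 0) * emb F (rnorm x)))//.
  rewrite -embM emb_le (le_trans (fM x))// ler_wpM2r ?rnorm_ge0//.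
  by rewrite le_max lexx.
by rewrite -embE ler_wpM2l// -[leLHS](emb0 R F) emb_le le_max lexx orbT.
Qed.

Lemma continuous_linear_is_bounded V W (f : {linear V -> W}) :
  continuous f -> exists M, bounded_linear M f.
Proof.
move=> fc; have := @continuous_linear_bounded _ _ _ 0 f (fc 0).
move=> /linear_boundedP/pinfty_ex_gt0[r r0 rf].
exists (scalar_re r); split=> [a x y|x]; first by rewrite linearP.
by rewrite -(emb_le F) embM (emb_re (ltW r0)) -!embE.
Qed.

(** This form lets maps that are merely known to be linear and bounded serve as
    test functionals. *)
Lemma weakly_cauchyP V (u : nat -> V) :
  weakly_cauchy u <->
  forall M (f : V -> K^o), bounded_linear M f -> seq_cauchy (fun n => f (u n)).
Proof.
split=> [h M f fM|h f fc].
  have [g gf] := exists_linear fM.1.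
  have gfE : g = f :> (V -> K^o) by apply/funext.
  have gc : continuous g by apply: (@bounded_linear_is_continuous _ _ M); rewrite gfE.
  by have /cauchy_rnormP := h g gc; rewrite gfE.
have [M fM] := continuous_linear_is_bounded fc.
by apply/cauchy_rnormP; exact: h fM.
Qed.

Lemma seq_limP V (u : nat -> V) x : u n @[n --> \oo] --> x <-> seq_lim u x.
Proof.
split=> [/cvg_rnormP h e /h [N _ Nh]|h]; first by exists N.
by apply/cvg_rnormP => e /h[N Nh]; exists N.
Qed.

Lemma weakly_convergesP V (u : nat -> V) x :
  weakly_converges u x <->
  forall M (f : V -> K^o), bounded_linear M f -> seq_lim (fun n => f (u n)) (f x).
Proof.
split=> [h M f fM|h f fc].
  have [g gf] := exists_linear fM.1.
  have gfE : g = f :> (V -> K^o) by apply/funext.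
  have gc : continuous g by apply: (@bounded_linear_is_continuous _ _ M); rewrite gfE.
  by have /seq_limP := h g gc; rewrite gfE.
have [M fM] := continuous_linear_is_bounded fc.
by apply/seq_limP; exact: h fM.
Qed.

End BoundedLinear.

Lemma complete_seq_lim (R : realType) (F : scalars)
    (V : completeNormedModType (scalar_field R F)) (u : nat -> V) :
  seq_cauchy u -> exists x, seq_lim u x.
Proof.
move=> /cauchy_rnormP/cauchy_cvgP/cvg_ex[x xu].
by exists x; apply/seq_limP.
Qed.

(** In the complex case the limit is assembled from the limits of the real and
    imaginary parts. *)
Lemma scalar_seq_lim (R : realType) (F : scalars)
    (u : nat -> (scalar_field R F)^o) :
  seq_cauchy u -> exists x, seq_lim u x.
Proof.
case: F u => u.
  move=> /(@cauchy_rnormP R RealScalars R^o) /cauchy_cvgP/cvg_ex[x xu].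
  by exists x; apply/seq_limP.
move=> uc.
have cC (g : R[i] -> R) : (forall x y, `|g x - g y| <= rnorm (x - y : KC R)) ->
    exists l : R, forall e : R, 0 < e ->
      exists N, forall n, (N <= n)%N -> `|l - g (u n)| <= e.
  move=> gl.
  have : seq_cauchy (fun n => g (u n) : (scalar_field R RealScalars)^o).
    move=> e /uc[N HN]; exists N => m n Nm Nn.
    by apply: le_trans (HN _ _ Nm Nn); exact: gl.
  move=> /(@cauchy_rnormP R RealScalars R^o) /cauchy_cvgP/cvg_ex[x xu].
  by exists x; exact: (@seq_limP R RealScalars R^o (fun n => g (u n)) x).1 xu.
have Re_le (k : R[i]) : `|complex.Re k| <= rnorm (k : KC R).
  by have := normc_ge_Re k; rewrite -(@emb_re R ComplexScalars (Num.norm k))// lecR.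
have ni : rnorm ('i%C : KC R) = 1.
  have -> : rnorm ('i%C : KC R) = complex.Re (Num.norm ('i%C : R[i])) by [].
  by rewrite normc_def/= expr0n/= expr1n add0r sqrtr1.
have nM (a b : R[i]) : rnorm (a * b : KC R) =
    rnorm (a : KC R) * rnorm (b : KC R).
  exact: (@rnormZ R ComplexScalars (KC R)).
have nC (a : R) : rnorm ((a%:C)%C : KC R) = `|a|.
  have -> : rnorm ((a%:C)%C : KC R) = complex.Re (Num.norm ((a%:C)%C : R[i])) by [].
  by rewrite normc_def/= expr0n/= addr0 sqrtr_sqr.
have [|a Ha] := cC (@complex.Re R).
  by move=> [a b] [c d]; exact: (Re_le ((a +i* b)%C - (c +i* d)%C)).
have Im_le (k : R[i]) : `|complex.Im k| <= rnorm (k : KC R).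
  by have := Re_le (k * 'i%C); rewrite ReiNIm normrN nM ni mulr1.
have [|b Hb] := cC (@complex.Im R).
  by move=> [a' b] [c d]; exact: (Im_le ((a' +i* b)%C - (c +i* d)%C)).
exists ((a +i* b)%C) => e e0.
have e20 : 0 < e / 2 by rewrite divr_gt0.
have [N1 h1] := Ha _ e20; have [N2 h2] := Hb _ e20.
exists (maxn N1 N2) => n; rewrite geq_max => /andP[/h1 {}h1 /h2 {}h2].
move: h1 h2; case: (u n) => c d /= h1 h2.
have E : ((a +i* b) - (c +i* d) = (a - c)%:C + 'i * (b - d)%:C)%C.
  by apply/eqP; rewrite eq_complex /=; apply/andP; split; apply/eqP; ring.
rewrite -[leLHS]/(rnorm ((a +i* b - (c +i* d))%C : KC R)).
rewrite E.
apply: le_trans (@rnormD R ComplexScalars (KC R) _ _) _.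
by rewrite (splitr e) nM ni mul1r !nC lerD.
Qed.

(** * Finite-rank maps and weak approximation *)

Section FiniteRank.
Variables (R : realType) (F : scalars).
Local Notation K := (scalar_field R F).
Implicit Types V W : normedModType K.

(** The inductive form allows one to remove rank-one terms one by one. *)
Inductive finite_rank V W : (V -> W) -> Prop :=
| finite_rank0 P : (forall x, P x = 0) -> finite_rank P
| finite_rankD P P' M (f : V -> K^o) (e : W) :
    0 <= M -> bounded_linear M f -> finite_rank P' ->
    (forall x, P x = P' x + f x *: e) -> finite_rank P.

(** Induction on the number of spanning vectors. Given [v = P x0 <> 0], a
    Hahn-Banach functional with [phi v = 1] splits off the rank-one map
    [phi (P _) v]. What remains has values in the kernel of [phi], and the
    vectors of the span of [e] killed by [phi] are spanned by the [n]
    combinations that eliminate some [e i] with [phi (e i) <> 0]. *)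
Lemma finite_rank_span V W M (P : V -> W) n (e : 'I_n -> W) :
  0 <= M -> bounded_linear M P ->
  (forall x, exists a : 'I_n -> K, P x = \sum_(k < n) a k *: e k) ->
  finite_rank P.
Proof.
elim: n => [|n IH] in M P e * => M0 Pl Pe.
  by apply: finite_rank0 => x; have [a ->] := Pe x; rewrite big_ord0.
have [P0|/existsNP[x0 /eqP Px0]] := pselect (forall x, P x = 0).
  exact: finite_rank0.
have [f [fl fn fv]] := norming_functional (P x0).
have fv0 : f (P x0) != 0.
  apply/eqP => h; move: fv; rewrite h rnorm0 => /esym/rnorm0_eq0/eqP.
  by rewrite (negPf Px0).
pose phi (w : W) : K^o := (f (P x0))^-1 *: f w.
have phil : linear phi.
  move=> a x y; rewrite /phi fl scalerDr; congr (_ + _).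
  by rewrite !scalerA mulrC.
have phiv : phi (P x0) = 1 by rewrite /phi /GRing.scale/= mulVf.
have phiB : bounded_linear (rnorm ((f (P x0))^-1 : K^o)) phi.
  by split=> // w; rewrite rnormZ ler_wpM2l ?rnorm_ge0.
have [i phii] : exists i, phi (e i) != 0.
  apply/not_existsP => h; have [a Pa] := Pe x0.
  have /eqP : phi (P x0) = 0.
    rewrite Pa (lin_sum phil) big1// => k _; rewrite (linZ phil).
    by have /negP/negPn/eqP -> := h k; rewrite scaler0.
  by rewrite phiv oner_eq0.
(* Each [e' j] lies in the kernel of [phi]. *)
pose e' (j : 'I_n) : W := e (lift i j) - (phi (e (lift i j)) / phi (e i)) *: e i.
pose P' (x : V) : W := P x - phi (P x) *: P x0.
have P'l : bounded_linear (M + rnorm ((f (P x0))^-1 : K^o) * M * rnorm (P x0)) P'.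
  apply: bounded_linearB => //.
  have [phiPl phiPn] := bounded_linear_comp (rnorm_ge0 _) phiB Pl.
  split=> [a x y|x].
    by rewrite phiPl -[_ *: phi (P x)]/(a * phi (P x)) scalerDl scalerA.
  by rewrite rnormZ mulrAC ler_wpM2r// rnorm_ge0.
apply: (@finite_rankD _ _ _ P' (rnorm ((f (P x0))^-1 : K^o) * M)
  (fun x => phi (P x)) (P x0)).
- by rewrite mulr_ge0 ?rnorm_ge0.
- exact: (bounded_linear_comp (rnorm_ge0 _) phiB Pl).
- apply: (IH _ _ e' _ P'l) => [|x].
    by rewrite addr_ge0 ?mulr_ge0 ?rnorm_ge0.
  have [a Pa] := Pe x; have [b Pb] := Pe x0.
  pose c k := a k - phi (P x) * b k.
  have P'c : P' x = \sum_(k < n.+1) c k *: e k.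
    rewrite /P' {1}Pa Pb scaler_sumr -sumrB; apply: eq_bigr => k _.
    by rewrite scalerA -scalerBl.
  have phiP' : phi (P' x) = 0.
    by rewrite /P' (linB phil) (linZ phil) phiv /GRing.scale/= mulr1 subrr.
  have phic : \sum_(j < n) c (lift i j) * phi (e (lift i j)) = - (c i * phi (e i)).
    apply/eqP; rewrite -addr_eq0 addrC; apply/eqP.
    rewrite -[RHS]phiP' P'c (lin_sum phil) (bigD1_ord i)//= (linZ phil).
    by congr (_ + _); apply: eq_bigr => j _; rewrite (linZ phil).
  exists (fun j => c (lift i j)).
  rewrite P'c (bigD1_ord i)//=.
  under [RHS]eq_bigr do rewrite scalerBr scalerA mulrA.
  rewrite sumrB addrC; congr (_ + _); rewrite -scaler_suml -mulr_suml -scaleNr.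
  by rewrite phic mulNr opprK mulfK.
- by move=> x; rewrite subrK.
Qed.

Lemma finite_rank_add V W (f g : V -> W) :
  finite_rank f -> finite_rank g -> finite_rank (fun x => f x + g x).
Proof.
move=> ff; elim: ff g => [f0 f00 g|f0 f1 M h e M0 hM _ IH f0E g] gf.
  by rewrite (_ : (fun x => f0 x + g x) = g)//; apply/funext => x; rewrite f00 add0r.
apply: (finite_rankD (e := e) M0 hM (IH _ gf)) => x.
by rewrite f0E addrAC.
Qed.

End FiniteRank.

Section Weak.
Variables (R : realType) (F : scalars).
Local Notation K := (scalar_field R F).
Implicit Types V W : normedModType K.

Lemma seq_lim_le V (u : nat -> V) x c N :
  seq_lim u x -> (forall n, (N <= n)%N -> rnorm (u n) <= c) -> rnorm x <= c.
Proof.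
move=> ux uc; apply/ler_addgt0Pr => e /ux[N' h].
have := uc _ (leq_maxl N N'); have := h _ (leq_maxr N N').
set y := u _ => h1 h2; rewrite -(subrK y x) addrC.
exact: le_trans (rnormD _ _) (lerD _ _).
Qed.

Lemma seq_limD V (u v : nat -> V) x y :
  seq_lim u x -> seq_lim v y -> seq_lim (fun n => u n + v n) (x + y).
Proof. by move=> /seq_limP ux /seq_limP vy; apply/seq_limP; exact: cvgD. Qed.

Lemma seq_limN V (u : nat -> V) x :
  seq_lim u x -> seq_lim (fun n => - u n) (- x).
Proof. by move=> /seq_limP ux; apply/seq_limP; exact: cvgN. Qed.

Lemma seq_lim_unique V (u : nat -> V) x y : seq_lim u x -> seq_lim u y -> x = y.
Proof.
move=> ux uy; apply/eqP; rewrite -subr_eq0; apply/eqP/rnorm0_eq0.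
apply/eqP; rewrite eq_le rnorm_ge0 andbT.
apply: (seq_lim_le (N := 0) (seq_limD ux (seq_limN uy))) => n _.
by rewrite subrr rnorm0.
Qed.

Lemma weakly_convergesD V (u v : nat -> V) x y :
  weakly_converges u x -> weakly_converges v y ->
  weakly_converges (fun n => u n + v n) (x + y).
Proof.
move=> /weakly_convergesP ux /weakly_convergesP vy; apply/weakly_convergesP.
move=> M f fM; rewrite (linD fM.1).
have -> : (fun n => f (u n + v n)) = (fun n => f (u n) + f (v n)).
  by apply/funext => n; rewrite (linD fM.1).
by apply: seq_limD; [exact: ux fM|exact: vy fM].
Qed.

Lemma weakly_converges_map V W M (g : V -> W) (u : nat -> V) x :
  0 <= M -> bounded_linear M g -> weakly_converges u x ->
  weakly_converges (fun n => g (u n)) (g x).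
Proof.
move=> M0 gM /weakly_convergesP ux; apply/weakly_convergesP => N f fN.
have fN' := bounded_linearW (ler_norm N) fN.
exact: (ux _ _ (bounded_linear_comp (normr_ge0 N) fN' gM)).
Qed.

Lemma weakly_cauchy_map V W M (g : V -> W) (u : nat -> V) :
  0 <= M -> bounded_linear M g -> weakly_cauchy u ->
  weakly_cauchy (fun n => g (u n)).
Proof.
move=> M0 gM /weakly_cauchyP ux; apply/weakly_cauchyP => N f fN.
have fN' := bounded_linearW (ler_norm N) fN.
exact: (ux _ _ (bounded_linear_comp (normr_ge0 N) fN' gM)).
Qed.

(** The norm is weakly lower semicontinuous because a norming functional of the
    limit does not increase the norms of the terms. *)
Lemma weak_limit_le V (u : nat -> V) x c N : weakly_converges u x ->
  (forall n, (N <= n)%N -> rnorm (u n) <= c) -> rnorm x <= c.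
Proof.
move=> /weakly_convergesP ux uc; have [f [fl fn fx]] := norming_functional x.
rewrite -fx; apply: (seq_lim_le (N := N) (ux 1 f _)) => [|n Nn].
  by split=> // y; rewrite mul1r.
exact: le_trans (fn _) (uc _ Nn).
Qed.

Lemma weakly_convergesB V (u v : nat -> V) x y :
  weakly_converges u x -> weakly_converges v y ->
  weakly_converges (fun n => u n - v n) (x - y).
Proof.
move=> ux vy; apply: weakly_convergesD => //.
apply: (@weakly_converges_map _ _ 1 (fun z => - z)) => //.
split=> [a z w|z]; first by rewrite opprD scalerN.
by rewrite rnormN mul1r.
Qed.
End Weak.

(** The weak limits [y k] of better and better approximations form a Cauchy
    sequence, by lower semicontinuity of the norm; its limit is the weak limit
    of [u]. *)
Lemma weakly_converges_approx (R : realType) (F : scalars)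
    (V : completeNormedModType (scalar_field R F)) (u : nat -> V) :
  (forall e : R, 0 < e -> exists v x N, weakly_converges v x /\
    forall n, (N <= n)%N -> rnorm (u n - v n) <= e) ->
  exists x, weakly_converges u x.
Proof.
move=> h; have {}h k : exists vx : (nat -> V) * V, weakly_converges vx.1 vx.2 /\
    exists N, forall n, (N <= n)%N -> rnorm (u n - vx.1 n) <= k.+1%:R^-1.
  have [|v [x [N [vx uv]]]] := h k.+1%:R^-1; first by rewrite invr_gt0.
  by exists (v, x); split=> //; exists N.
have {h} [g hg] := choice h.
pose v k := (g k).1; pose y k := (g k).2.
have vy k : weakly_converges (v k) (y k) by exact: (hg k).1.
have uv k : exists N, forall n, (N <= n)%N -> rnorm (u n - v k n) <= k.+1%:R^-1.
  exact: (hg k).2.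
have yy k l : rnorm (y k - y l) <= k.+1%:R^-1 + l.+1%:R^-1.
  have [N1 h1] := uv k; have [N2 h2] := uv l.
  apply: (weak_limit_le (N := maxn N1 N2) (weakly_convergesB (vy k) (vy l))) => n.
  rewrite geq_max => /andP[/h1 {}h1 /h2 {}h2].
  rewrite -(subrKA (u n)) (le_trans (rnormD _ _))// lerD//.
  by rewrite rnormC.
have [|x yx] := @complete_seq_lim _ _ _ y.
  move=> e e0; have [|N hN] := @inv_succ_small R (e / 2); first by rewrite divr_gt0.
  by exists N => m n /hN hm /hN hn; rewrite (le_trans (yy _ _))// [leRHS]splitr lerD.
exists x; apply/weakly_convergesP => M0 f /(bounded_linearW (ler_norm M0)).
move: `|M0| (normr_ge0 M0) => {M0} M M0 fM e e0.
pose d := e / (2 * M + 1 + 1).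
have t0 : 0 < 2 * M + 1 + 1 by lra.
have d0 : 0 < d by rewrite divr_gt0.
have de : M * d + (d + M * d) <= e.
  have : d * (2 * M + 1 + 1) = e by rewrite divfK// gt_eqF.
  by nra.
have [N1 h1] := inv_succ_small d0; have [N2 h2] := yx d d0.
pose k := maxn N1 N2; have [N3 h3] := uv k.
have /weakly_convergesP/(_ _ _ fM _ d0)[N4 h4] := vy k.
exists (maxn N3 N4) => n; rewrite geq_max => /andP[/h3 {}h3 /h4 {}h4].
apply: le_trans de.
have -> : f x - f (u n) = f (x - y k) + ((f (y k) - f (v k n)) - f (u n - v k n)).
  by rewrite !(linB fM.1) opprB !subrKA.
apply: le_trans (rnormD _ _) _; apply: lerD.
  apply: le_trans (fM.2 _) _; rewrite ler_wpM2l//; apply: h2; exact: leq_maxr.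
apply: le_trans (rnormB _ _) _; apply: lerD => //.
apply: le_trans (fM.2 _) _; rewrite ler_wpM2l//; apply: le_trans h3 _.
by apply: h1; exact: leq_maxl.
Qed.

(** * The Schur property of l1-sums *)

Lemma bounded_series_tail (R : realType) (a : nat -> R) M :
  (forall k, 0 <= a k) -> (forall n, \sum_(0 <= k < n) a k <= M) ->
  forall e : R, 0 < e -> exists K, forall n, \sum_(K <= k < n) a k <= e.
Proof.
move=> a0 aM e e0; pose S := [set \sum_(0 <= k < n) a k | n in [set: nat]].
have hS : has_sup S.
  by split; [exists (\sum_(0 <= k < 0) a k); exists 0|exists M => _ [n _ <-]].
have [_ [k _ <-] hk] := sup_adherent e0 hS.
exists k => n; have [nk|kn] := leqP n k; first by rewrite big_geq// ltW.
have : \sum_(0 <= i < n) a i <= sup S by apply: ub_le_sup; [exact: hS.2|exists n].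
rewrite (big_cat_nat (leq0n k) (ltnW kn))/=; lra.
Qed.

Lemma pointwise_limit_linear (R : realType) (F : scalars)
    (V W : normedModType (scalar_field R F)) (Psi : nat -> V -> W) (Phi : V -> W) :
  (forall j, linear (Psi j)) -> (forall x, seq_lim (fun j => Psi j x) (Phi x)) ->
  linear Phi.
Proof.
move=> Pl PP a x y; apply: (seq_lim_unique (PP _)).
have -> : (fun j => Psi j (a *: x + y)) = (fun j => a *: Psi j x + Psi j y).
  by apply/funext => j; exact: Pl.
apply: seq_limD (PP y).
have /seq_limP xx := PP x; apply/seq_limP.
exact: cvgZl_tmp.
Qed.

Section Schur.
Variables (R : realType) (F : scalars).
Local Notation K := (scalar_field R F).
Variables V W : normedModType K.

Variables (T : nat -> V -> W) (M : R) (u : nat -> V).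
Hypothesis Tl : forall k, linear (T k).
Hypothesis TM : forall n x, \sum_(0 <= k < n) rnorm (T k x) <= M * rnorm x.
Hypothesis uc : weakly_cauchy u.

Implicit Types x : V.

Let Tb k x : rnorm (T k x) <= M * rnorm x.
Proof.
apply: le_trans (TM k.+1 x); rewrite big_nat_recr//= lerDr.
by apply: sumr_ge0 => i _; exact: rnorm_ge0.
Qed.

Let tail K x n := \sum_(K <= k < n) rnorm (T k x).

Let tail_le K K' x n : (K <= K')%N -> tail K' x n <= tail K x n.
Proof.
move=> KK; rewrite /tail; have [nK|Kn] := leqP n K'.
  by rewrite big_geq// sumr_ge0// => i _; exact: rnorm_ge0.
rewrite [leRHS](big_cat_nat KK (ltnW Kn))/= lerDr.
by apply: sumr_ge0 => i _; exact: rnorm_ge0.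
Qed.

Let tail_small x (e : R) : 0 < e -> exists K, forall n, tail K x n <= e.
Proof.
by apply: bounded_series_tail => [k|n]; [exact: rnorm_ge0|exact: (TM n x)].
Qed.

(** One hump. The first component of a state is the number of coordinates used
    so far, the second one the functional built on them. A step adds a
    functional of a single later coordinate [T k], so chosen that the new
    functional separates [u m] from [u n]; enough coordinates are then skipped
    for [u m] and [u n] to have small tails, so that later steps cannot undo
    the separation. *)
Let step (e : R) (s s' : nat * (V -> K^o)) :=
  [/\ (s.1 < s'.1)%N, exists N, bounded_linear N s'.2,
    forall x, rnorm (s'.2 x - s.2 x) <= \sum_(s.1 <= k < s'.1) rnorm (T k x) &
    exists m n, [/\ (s.1 <= m)%N, (s.1 <= n)%N,
      forall l, tail s'.1 (u m) l <= e, forall l, tail s'.1 (u n) l <= e &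
      6 * e <= rnorm (s'.2 (u n) - s'.2 (u m))]].

Let step_exists (e : R) (s : nat * (V -> K^o)) : 0 < e ->
  (forall N, exists k n, [/\ (N <= k)%N, (N <= n)%N & 8 * e < rnorm (T k (u n))]) ->
  (exists N, bounded_linear N s.2) -> exists s', step e s s'.
Proof.
case: s => k0 psi /= e0 big [B psiB].
have /weakly_cauchyP/(_ _ _ psiB _ e0)[N hN] := uc.
(* From [m] on, the old functional [psi] no longer separates the terms. The
   coordinate [k] is taken where [u m] is small and [u n] is large, so the
   functional norming [T k (u n)] separates [u n] from [u m]. *)
pose m := maxn N k0.
have [K1 hK1] := tail_small (u m) e0.
have [k [n []]] := big (maxn K1 m).
rewrite !geq_max => /andP[K1k /andP[Nk k0k]] /andP[K1n /andP[Nn k0n]] kn.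
have [phi [phil phin phik]] := norming_functional (T k (u n)).
have [K2 hK2] := tail_small (u n) e0.
exists (maxn k.+1 K2, fun x => psi x + phi (T k x)); split => /=.
- by rewrite leq_max ltnS k0k.
- exists (B + 1 * M); apply: bounded_linearD => //.
  apply: (bounded_linear_comp ler01 (conj phil _) (conj (Tl k) (Tb k))) => x.
  by rewrite mul1r.
- move=> x; rewrite addrAC subrr add0r; apply: le_trans (phin _) _.
  rewrite (big_cat_nat (leqW k0k) (leq_maxl k.+1 K2))/=.
  rewrite big_nat_recr//= -addrA addrCA lerDl addr_ge0//.
    by apply: sumr_ge0 => i _; exact: rnorm_ge0.
  by apply: sumr_ge0 => i _; exact: rnorm_ge0.
exists m, n; split=> // [|l|l|].
- by rewrite leq_max leqnn orbT.
- apply: le_trans (hK1 l); apply: tail_le.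
  by rewrite leq_max (leq_trans K1k).
- by apply: le_trans (hK2 l); apply: tail_le; rewrite leq_max leqnn orbT.
have h1 : rnorm (psi (u m) - psi (u n)) <= e by apply: hN => //; rewrite leq_max leqnn.
have h2 : rnorm (phi (T k (u m))) <= e.
  apply: le_trans (phin _) _; apply: le_trans (hK1 k.+1).
  rewrite /tail big_nat_recr//= lerDr.
  by apply: sumr_ge0 => i _; exact: rnorm_ge0.
have := rnormD (psi (u n) + phi (T k (u n)) - (psi (u m) + phi (T k (u m))))
  ((psi (u m) - psi (u n)) + phi (T k (u m))).
have -> : psi (u n) + phi (T k (u n)) - (psi (u m) + phi (T k (u m))) +
  ((psi (u m) - psi (u n)) + phi (T k (u m))) = phi (T k (u n)).
  by rewrite [psi (u m) - _ + _]addrAC subrKA addrAC subrr add0r.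
rewrite phik; have := rnormD (psi (u m) - psi (u n)) (phi (T k (u m))).
lra.
Qed.

(** The maps [T k] are the coordinates of a bounded operator into an l1-sum,
    and the claim is that the coordinates of [u n] tend to 0 jointly in [k] and
    [n]. Otherwise infinitely many humps add up to one functional [Phi],
    bounded because of the l1-estimate, for which [Phi (u n)] is not Cauchy. *)
Lemma l1_schur (e : R) : 0 < e -> exists N, forall k n, (N <= k)%N -> (N <= n)%N ->
  rnorm (T k (u n)) <= e.
Proof.
move=> e0; apply: contrapT => /forallNP H.
have e80 : 0 < e / 8 by rewrite divr_gt0.
(* Write d for e / 8. A step separates by 8 d less one d for the old functional
   and one d for T k (u m); passing to the limit functional costs one more d
   for each of u m and u n, and 4 d is left. *)
have {H} big N : exists k n,
    [/\ (N <= k)%N, (N <= n)%N & 8 * (e / 8) < rnorm (T k (u n))].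
  have /existsNP[k /existsNP[n /not_implyP[Nk /not_implyP[Nn /negP]]]] := H N.
  by rewrite -ltNge => h; exists k, n; split=> //; rewrite mulrC divfK.
pose S := {s : nat * (V -> K^o) | exists N, bounded_linear N s.2}.
have next (s : S) : exists s' : S, step (e / 8) (sval s) (sval s').
  have [s' st] := step_exists e80 big (svalP s).
  have [_ bs' _ _] := st.
  by exists (exist _ s' bs').
have {next} [next hnext] := choice next.
have b0 : exists N, bounded_linear N ((fun=> 0) : V -> K^o).
  exists 0; split=> [a x y|x]; first by rewrite scaler0 addr0.
  by rewrite rnorm0 mul0r.
pose s j : nat * (V -> K^o) := sval (iter j next (exist _ (0%N, fun=> 0) b0 : S)).
have st j : step (e / 8) (s j) (s j.+1) by exact: hnext.
have sl j : linear (s j).2.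
  by have [N [tl _]] := svalP (iter j next (exist _ (0%N, fun=> 0) b0 : S)); exact: tl.
have Kj j : (j <= (s j).1)%N.
  elim: j => // j IH; have [h _ _ _] := st j; exact: leq_ltn_trans IH h.
have Kle j i : ((s j).1 <= (s (j + i)%N).1)%N.
  elim: i => [|i IH]; first by rewrite addn0.
  by rewrite addnS; have [h _ _ _] := st (j + i)%N; exact: leq_trans IH (ltnW h).
have diff j i x :
    rnorm ((s (j + i)%N).2 x - (s j).2 x) <= tail (s j).1 x (s (j + i)%N).1.
  elim: i => [|i IH]; first by rewrite addn0 subrr rnorm0 /tail big_geq.
  rewrite addnS -(subrKA ((s (j + i)%N).2 x)) (le_trans (rnormD _ _))//.
  have [h _ h' _] := st (j + i)%N.
  by rewrite /tail (big_cat_nat (Kle j i) (ltnW h))/= addrC lerD.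
have lim x : exists l : K^o, seq_lim (fun j => (s j).2 x) l.
  apply: scalar_seq_lim => d d0.
  have [|N hN] := @tail_small x (d / 2); first by rewrite divr_gt0.
  have hj j : (N <= j)%N -> rnorm ((s j).2 x - (s N).2 x) <= d / 2.
    move=> Nj; rewrite -(subnKC Nj); apply: le_trans (diff _ _ _) _.
    by apply: le_trans (hN (s (N + (j - N))%N).1); apply: tail_le.
  exists N => m n /hj hm /hj hn.
  rewrite -(subrKA ((s N).2 x)) (le_trans (rnormD _ _))// [leRHS]splitr lerD//.
  by rewrite rnormC.
have {lim} [Phi hPhi] := choice lim.
have tail_lim j x d :
    (forall l, tail (s j).1 x l <= d) -> rnorm (Phi x - (s j).2 x) <= d.
  move=> hd; have h0 : seq_lim (fun i => (s i).2 x - (s j).2 x) (Phi x - (s j).2 x).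
    apply: seq_limD; first exact: hPhi.
    by move=> d' d'0; exists 0 => n _; rewrite subrr rnorm0 ltW.
  apply: (seq_lim_le (N := j) h0) => n jn; rewrite -(subnKC jn).
  exact: le_trans (diff _ _ _) (hd _).
have Phib : bounded_linear M Phi.
  split; first exact: (pointwise_limit_linear sl hPhi).
  move=> x; have := @tail_lim 0 x (M * rnorm x); rewrite subr0; apply=> l.
  exact: TM.
have /weakly_cauchyP/(_ _ _ Phib _ e80)[N hN] := uc.
have [_ _ _ [m [n [Km Kn hm hn big']]]] := st N.
have h1 := hN m n (leq_trans (Kj N) Km) (leq_trans (Kj N) Kn).
have h2 := tail_lim _ _ _ hm.
have h3 := tail_lim _ _ _ hn.
move: big' h1 h2 h3 e80.
set a := (s N.+1).2 (u n); set b := (s N.+1).2 (u m).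
set a' := Phi (u n); set b' := Phi (u m) => big' h1 h2 h3 e80.
have : rnorm (a - b) <= rnorm (a' - a) + (rnorm (b' - a') + rnorm (b' - b)).
  have -> : a - b = (a - a') + ((a' - b') + (b' - b)) by rewrite !subrKA.
  apply: le_trans (rnormD _ _) _; rewrite rnormC lerD2l.
  by apply: le_trans (rnormD _ _) _; rewrite rnormC lerD2r.
lra.
Qed.

End Schur.

(** * The universal property of the projective tensor product *)

Section BoundedBilinear.
Variables (R : realType) (F : scalars).
Local Notation K := (scalar_field R F).

Definition bounded_bilinear (X Y W : normedModType K) (M : R) (b : X -> Y -> W) :=
  [/\ forall y, linear (b^~ y), forall x, linear (b x) &
      forall x y, rnorm (b x y) <= M * (rnorm x * rnorm y)].

Variables X Y : normedModType K.

Lemma exists_bilinear (W : normedModType K) (b : X -> Y -> W) :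
  (forall y, linear (b^~ y)) -> (forall x, linear (b x)) ->
  exists g : {bilinear X -> Y -> W}, forall x y, g x y = b x y.
Proof.
move=> bl br.
have bP : bilinear_for *:%R *:%R b by split.
pose g : {bilinear X -> Y -> W} :=
  HB.pack b (@bilinear_isBilinear.Build _ _ _ _ _ _ b bP).
by exists g.
Qed.

(** The definition of [same_tensor] tests with scalar forms only; composing a
    vector-valued map with norming functionals reduces to that case. *)
Lemma same_tensor_sum (W : normedModType K) M (b : X -> Y -> W) s s' :
  bounded_bilinear M b -> same_tensor s s' ->
  \sum_(z <- s) b z.1 z.2 = \sum_(z <- s') b z.1 z.2.
Proof.
move=> [bl br _] ss; apply/eqP; rewrite -subr_eq0; apply/eqP.
have [f [fl _ fv]] := norming_functional
  (\sum_(z <- s) b z.1 z.2 - \sum_(z <- s') b z.1 z.2).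
apply: rnorm0_eq0; rewrite -fv.
have [||g gE] := @exists_bilinear K^o (fun x y => f (b x y)).
- by move=> y a x x'; rewrite bl fl.
- by move=> x a y y'; rewrite br fl.
have := ss g.
under eq_bigr do rewrite gE.
under [RHS]eq_bigr do rewrite gE.
by rewrite (linB fl) !(lin_sum fl) => ->; rewrite subrr rnorm0.
Qed.

End BoundedBilinear.

Section Tensor.
Variables (R : realType) (F : scalars).
Local Notation K := (scalar_field R F).
Variables (X Y : normedModType K) (Z : completeNormedModType K)
  (t : {bilinear X -> Y -> Z}).
Hypothesis tP : is_projective_tensor_product t.

Local Notation tsum s := (\sum_(z <- s) t z.1 z.2).
Local Notation cost s := (\sum_(z <- s) rnorm z.1 * rnorm z.2).

Let proj_has_inf (s : seq (X * Y)) :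
  has_inf [set cost s' | s' in same_tensor s].
Proof.
split; first by exists (cost s), s.
exists 0 => _ [s' _ <-]; apply: sumr_ge0 => z _.
by rewrite mulr_ge0 ?rnorm_ge0.
Qed.

Lemma tensor_bounded : bounded_bilinear 1 t.
Proof.
split=> [y a x x'|x a y y'|x y]; rewrite ?linearPl ?linearPr//.
have := tP.1 [:: (x, y)]; rewrite big_seq1 /= mul1r => ->.
apply: ge_inf; first exact: (proj_has_inf _).2.
by exists [:: (x, y)] => //; rewrite big_seq1.
Qed.

(** Density gives some finite sum of elementary tensors near [z]; as its norm is
    an infimum of costs, it has a representation whose cost is nearly its
    norm. *)
Lemma tensor_approx (z : Z) (e : R) : 0 < e ->
  exists s, rnorm (z - tsum s) <= e /\ cost s <= rnorm z + e.
Proof.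
move=> e0; have e20 : 0 < e / 2 by rewrite divr_gt0.
have he : 0 < emb F (e / 2) by rewrite -(emb0 R F) emb_lt.
have [|w []] := tP.2 (ball z (emb F (e / 2))) _ (ball_open _ _).
  by exists z; exact: ballxx.
rewrite -ball_normE /= embE emb_lt => /ltW zw [s _ sw]; subst w.
have [_ [s' ss' <-] hs'] := inf_adherent e20 (proj_has_inf s).
exists s'; rewrite -(same_tensor_sum tensor_bounded ss'); split.
  by apply: le_trans zw _; lra.
apply: (le_trans (ltW hs')); rewrite -[inf _]tP.1.
have := rnormB z (z - tsum s); rewrite opprB addrC subrK; lra.
Qed.

Lemma sum_bilinear_le (W : normedModType K) M (b : X -> Y -> W) s :
  0 <= M -> bounded_bilinear M b ->
  rnorm (\sum_(z <- s) b z.1 z.2) <= M * rnorm (tsum s).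
Proof.
move=> M0 bM; have [bl br bn] := bM; apply/ler_addgt0Pr => e e0.
have d0 : 0 < e / (M + 1) by rewrite divr_gt0// ltr_wpDl.
have [_ [s' ss' <-] hs'] := inf_adherent d0 (proj_has_inf s).
rewrite (same_tensor_sum bM ss'); apply: le_trans (rnorm_sum _ _) _.
apply: le_trans (_ : M * cost s' <= _).
  by rewrite mulr_sumr; apply: ler_sum => z _; exact: bn.
apply: le_trans (ler_wpM2l M0 (ltW hs')) _; rewrite tP.1 mulrDr lerD2l.
by rewrite mulrA ler_pdivrMr ?ltr_wpDl// mulrC ler_wpM2l ?ltW// ltrDl.
Qed.

(** The closure of the graph of the map that sends a finite sum of elementary
    tensors to the sum of the values of [b]. *)
Let ext_graph (W : normedModType K) (b : X -> Y -> W) (z : Z) (w : W) :=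
  forall e : R, 0 < e -> exists s,
    rnorm (z - tsum s) <= e /\ rnorm (w - \sum_(z <- s) b z.1 z.2) <= e.

(** The closed graph is that of a function: [sum_bilinear_le] bounds its second
    coordinate by its first, whence uniqueness, and existence follows from it
    by completeness of [W]. *)
Lemma tensor_lift (W : completeNormedModType K) M (b : X -> Y -> W) :
  0 <= M -> bounded_bilinear M b ->
  exists f : Z -> W, bounded_linear M f /\ forall x y, f (t x y) = b x y.
Proof.
move=> M0 bM; have [bl br bn] := bM.
pose bsum s := \sum_(z <- s) b z.1 z.2.
pose sc a (s : seq (X * Y)) := [seq (a *: z.1, z.2) | z <- s].
have tsc a s : tsum (sc a s) = a *: tsum s.
  rewrite big_map scaler_sumr; apply: eq_bigr => z _ /=; exact: linearZl_LR.
have bsc a s : bsum (sc a s) = a *: bsum s.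
  rewrite /bsum big_map scaler_sumr; apply: eq_bigr => z _ /=.
  exact: (linZ (bl _)).
have bound z w : ext_graph b z w -> rnorm w <= M * rnorm z.
  move=> G; apply/ler_addgt0Pr => e e0.
  have d0 : 0 < e / (M + 1) by rewrite divr_gt0// ltr_wpDl.
  have [s [zs ws]] := G _ d0.
  have h1 := rnormD (w - bsum s) (bsum s); rewrite subrK in h1.
  have h2 := sum_bilinear_le s M0 bM.
  have h3 := rnormB z (z - tsum s); rewrite opprB addrC subrK in h3.
  have h4 : rnorm (tsum s) <= rnorm z + e / (M + 1).
    by apply: le_trans h3 _; rewrite lerD2l.
  have h5 : (M + 1) * (e / (M + 1)) = e by rewrite mulrC divfK// gt_eqF// ltr_wpDl.
  have h6 := ler_wpM2l M0 h4.
  move: ws; rewrite -/(bsum s) => ws.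
  apply: (le_trans h1); apply: (le_trans (lerD ws (le_trans h2 h6))).
  by rewrite -[X in _ <= _ + X]h5; lra.
have lin a z w z' w' : ext_graph b z w -> ext_graph b z' w' ->
    ext_graph b (a *: z + z') (a *: w + w').
  move=> G G' e e0.
  have d0 : 0 < e / (rnorm (a : K^o) + 1) by rewrite divr_gt0// ltr_wpDl ?rnorm_ge0.
  have de : (rnorm (a : K^o) + 1) * (e / (rnorm (a : K^o) + 1)) = e.
    by rewrite mulrC divfK// gt_eqF// ltr_wpDl ?rnorm_ge0.
  have [s [zs ws]] := G _ d0; have [s' [zs' ws']] := G' _ d0.
  exists (sc a s ++ s'); rewrite !big_cat/= tsc -/(bsum _) bsc.
  rewrite -de mulrDl mul1r; split.
    rewrite opprD addrACA -scalerBr; apply: le_trans (rnormD _ _) _.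
    by rewrite rnormZ lerD// ler_wpM2l ?rnorm_ge0.
  rewrite opprD addrACA -scalerBr; apply: le_trans (rnormD _ _) _.
  by rewrite rnormZ lerD// ler_wpM2l ?rnorm_ge0.
have ex z : exists w, ext_graph b z w.
  have h k : exists s, rnorm (z - tsum s) <= k.+1%:R^-1.
    by have [|s [zs _]] := @tensor_approx z k.+1%:R^-1; [rewrite invr_gt0|exists s].
  have [s hs] := choice h.
  have [|w hw] := @complete_seq_lim _ _ W (fun n => bsum (s n)).
    move=> e e0; have [|N hN] := @inv_succ_small R (e / (M + 1) / 2).
      by rewrite !divr_gt0// ltr_wpDl.
    exists N => m n /hN hm /hN hn.
    have := sum_bilinear_le (s m ++ sc (-1) (s n)) M0 bM.
    rewrite !big_cat/= tsc -!/(bsum _) bsc !scaleN1r => /le_trans; apply.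
    rewrite -(subrKA z).
    have := rnormD (tsum (s m) - z) (z - tsum (s n)).
    rewrite (rnormC _ z).
    have := hs m; have := hs n; set A := rnorm _; set B := rnorm _; set C := rnorm _.
    move=> hB hA hC.
    have h5 : (M + 1) * (e / (M + 1)) = e by rewrite mulrC divfK// gt_eqF// ltr_wpDl.
    have D0 : 0 < e / (M + 1) by rewrite divr_gt0// ltr_wpDl.
    move: hm hn h5 D0; set D := e / (M + 1) => hm hn h5 D0.
    have CD : C <= D.
      apply: (le_trans hC); rewrite [leRHS]splitr.
      exact: lerD (le_trans hA hm) (le_trans hB hn).
    by apply: le_trans (ler_wpM2l M0 CD) _; rewrite -h5 mulrDl mul1r lerDl ltW.
  exists w => e e0; have [N1 h1] := inv_succ_small e0; have [N2 h2] := hw e e0.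
  exists (s (maxn N1 N2)); split; last by apply: h2; exact: leq_maxr.
  by apply: le_trans (hs _) (h1 _ (leq_maxl _ _)).
have [f hf] := choice ex.
have uniq z w w' : ext_graph b z w -> ext_graph b z w' -> w = w'.
  move=> G G'; have := bound _ _ (lin (-1) _ _ _ _ G G').
  rewrite !scaleN1r addNr rnorm0 mulr0 => h; apply/eqP.
  rewrite eq_sym -subr_eq0 addrC; apply/eqP/rnorm0_eq0/eqP.
  by rewrite eq_le h rnorm_ge0.
exists f; split; first split.
- by move=> a z z'; apply: uniq (hf _) (lin _ _ _ _ _ (hf z) (hf z')).
- by move=> z; exact: bound.
- move=> x y; apply: uniq (hf _) _ => e e0.
  by exists [:: (x, y)]; rewrite !big_seq1/= !subrr !rnorm0 ltW.
Qed.

Lemma tensor_ext (W : normedModType K) M N (f g : Z -> W) :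
  bounded_linear M f -> bounded_linear N g ->
  (forall x y, f (t x y) = g (t x y)) -> forall z, f z = g z.
Proof.
move=> fM gN fg z; apply/eqP; rewrite -subr_eq0; apply/eqP/rnorm0_eq0/eqP.
rewrite eq_le rnorm_ge0 andbT; apply/ler_addgt0Pr => e e0; rewrite add0r.
have [hl hn] := bounded_linearW (ler_norm _) (bounded_linearB fM gN).
have d0 : 0 < e / (`|M + N| + 1) by rewrite divr_gt0// ltr_wpDl.
have [s [zs _]] := tensor_approx z d0.
have hs : f (tsum s) - g (tsum s) = 0.
  apply/eqP; rewrite subr_eq0 (lin_sum fM.1) (lin_sum gN.1); apply/eqP.
  by apply: eq_bigr => ? _.
have := hn (z - tsum s); rewrite (linB fM.1) (linB gN.1).
rewrite opprD addrACA -opprD hs subr0 => /le_trans; apply.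
apply: le_trans (ler_wpM2l (normr_ge0 _) zs) _.
by rewrite mulrA ler_pdivrMr ?ltr_wpDl// mulrC ler_wpM2l ?ltW// ltrDl.
Qed.

End Tensor.

(** * Tensor products of operators *)

Section TensorMap.
Variables (R : realType) (F : scalars).
Local Notation K := (scalar_field R F).
Variables (X Y : normedModType K) (Z : completeNormedModType K)
  (t : {bilinear X -> Y -> Z}).
Hypothesis tP : is_projective_tensor_product t.

Local Notation tsum s := (\sum_(z <- s) t z.1 z.2).
Local Notation cost s := (\sum_(z <- s) rnorm z.1 * rnorm z.2).

(** The operator A (x) B, unique by [tensor_ext] when [A] and [B] are bounded. *)
Definition tensor_map (A : X -> X) (B : Y -> Y) : Z -> Z :=
  xget (fun=> 0) [set G | (exists M, bounded_linear M G) /\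
    forall x y, G (t x y) = t (A x) (B y)].

Lemma tensor_mapP a b A B : 0 <= a -> 0 <= b ->
  bounded_linear a A -> bounded_linear b B ->
  bounded_linear (a * b) (tensor_map A B) /\
  forall x y, tensor_map A B (t x y) = t (A x) (B y).
Proof.
move=> a0 b0 [Al An] [Bl Bn]; have [tl tr tn] := tensor_bounded tP.
have [||G [GM GE]] :=
  @tensor_lift _ _ _ _ _ _ tP Z (a * b) (fun x y => t (A x) (B y)).
- exact: mulr_ge0.
- split=> [y c x x'|x c y y'|x y]; rewrite ?Al ?Bl ?tl ?tr//.
  apply: le_trans (tn _ _) _; rewrite mul1r mulrACA.
  by rewrite ler_pM ?rnorm_ge0.
have [[M' hM] HE] : [set G | (exists M, bounded_linear M G) /\
    forall x y, G (t x y) = t (A x) (B y)] (tensor_map A B).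
  by apply: xgetPex; exists G; split=> //; exists (a * b).
suff -> : tensor_map A B = G by [].
apply/funext.
by apply: (tensor_ext tP hM GM) => x y; rewrite HE GE.
Qed.

(** Both sides are compared on a representation of [z] of nearly minimal cost,
    where the hypothesis applies to each elementary tensor. The uniform bounds
    [a] and [b] serve only to pass from the dense subspace to [z]; they do not
    enter the constant. *)
Lemma tensor_map_l1 (A : nat -> X -> X) (B : nat -> Y -> Y) a b M n :
  0 <= a -> 0 <= b -> 0 <= M ->
  (forall k, bounded_linear a (A k)) -> (forall k, bounded_linear b (B k)) ->
  (forall x y, \sum_(0 <= k < n) rnorm (A k x) * rnorm (B k y) <=
    M * (rnorm x * rnorm y)) ->
  forall z, \sum_(0 <= k < n) rnorm (tensor_map (A k) (B k) z) <= M * rnorm z.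
Proof.
move=> a0 b0 M0 Aa Bb ABM z; apply/ler_addgt0Pr => e e0.
(* The total error of an approximation of [z] up to [e / D] is
   [n * (a * b) * (e / D)] on the left and [M * (e / D)] on the right. *)
pose D := n%:R * (a * b) + M + 1.
have D0 : 0 < D by rewrite ltr_wpDl// addr_ge0// !mulr_ge0.
have d0 : 0 < e / D by rewrite divr_gt0.
have De : D * (e / D) = e by rewrite mulrC divfK// gt_eqF.
have [s [zs cs]] := tensor_approx tP z d0.
apply: le_trans (_ : \sum_(0 <= k < n)
  (a * b * (e / D) + \sum_(w <- s) rnorm (A k w.1) * rnorm (B k w.2)) <= _).
  apply: ler_sum => k _; have [[Tl Tn] TE] := tensor_mapP a0 b0 (Aa k) (Bb k).
  rewrite -{1}(subrK (tsum s) z) (linD Tl); apply: le_trans (rnormD _ _) _.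
  apply: lerD.
    by apply: le_trans (Tn _) _; rewrite ler_wpM2l// mulr_ge0.
  rewrite (lin_sum Tl); apply: le_trans (rnorm_sum _ _) _.
  apply: ler_sum => w _; rewrite TE.
  by have [_ _ tn] := tensor_bounded tP; have := tn (A k w.1) (B k w.2); rewrite mul1r.
rewrite big_split/= exchange_big/= sumr_const_nat subn0.
apply: le_trans (_ : n%:R * (a * b) * (e / D) + M * (rnorm z + e / D) <= _).
  apply: lerD; first by rewrite -[leLHS]mulr_natl !mulrA.
  apply: le_trans (_ : M * cost s <= _); last exact: ler_wpM2l.
  by rewrite mulr_sumr; apply: ler_sum => w _; exact: ABM.
move: De d0; rewrite /D; set d := e / _ => De d0; lra.
Qed.

(** Strong convergence of the factors gives convergence on elementary tensors,
    hence on finite sums of them, and the uniform bound carries it over to the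
    closure. *)
Lemma tensor_map_cvg (T : Type) (G : set_system T) (FG : Filter G)
    (A : T -> X -> X) (B : T -> Y -> Y) A' B' a b : 0 <= a -> 0 <= b ->
  (forall i, bounded_linear a (A i)) -> (forall i, bounded_linear b (B i)) ->
  bounded_linear a A' -> bounded_linear b B' ->
  (forall x, A i x @[i --> G] --> A' x) -> (forall y, B i y @[i --> G] --> B' y) ->
  forall z, tensor_map (A i) (B i) z @[i --> G] --> tensor_map A' B' z.
Proof.
move=> a0 b0 Aa Bb A'a B'b AA' BB' z.
have [tl tr tn] := tensor_bounded tP.
have [[Tl' Tn'] TE'] := tensor_mapP a0 b0 A'a B'b.
have TiP i := tensor_mapP a0 b0 (Aa i) (Bb i).
have elem x y (e : R) : 0 < e ->
    \forall i \near G, rnorm (t (A' x) (B' y) - t (A i x) (B i y)) <= e.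
  move=> e0.
  pose D := b * rnorm y + a * rnorm x + 1.
  have D0 : 0 < D by rewrite ltr_wpDl// addr_ge0// mulr_ge0// rnorm_ge0.
  have d0 : 0 < e / D by rewrite divr_gt0.
  have De : D * (e / D) = e by rewrite mulrC divfK// gt_eqF.
  have /cvg_rnormP/(_ _ d0) h1 := AA' x; have /cvg_rnormP/(_ _ d0) h2 := BB' y.
  apply: filterS2 h1 h2 => i h1 h2.
  have -> : t (A' x) (B' y) - t (A i x) (B i y) =
      t (A' x - A i x) (B' y) + t (A i x) (B' y - B i y).
    by rewrite (linB (tl _)) (linB (tr _)) subrKA.
  apply: le_trans (rnormD _ _) _.
  apply: le_trans (lerD (tn _ _) (tn _ _)) _; rewrite !mul1r.
  apply: le_trans (_ : e / D * (b * rnorm y) + a * rnorm x * (e / D) <= _).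
    have [_ B'n] := B'b; have [_ An] := Aa i.
    by apply: lerD; apply: ler_pM; rewrite ?rnorm_ge0.
  by move: De d0; rewrite /D; set d := e / _ => De d0; lra.
have fin s (e : R) : 0 < e ->
    \forall i \near G,
      rnorm (tensor_map A' B' (tsum s) - tensor_map (A i) (B i) (tsum s)) <= e.
  elim: s e => [|[x y] s IH] e e0.
    apply: filterE => i; rewrite big_nil (lin0 Tl') (lin0 (TiP i).1.1).
    by rewrite subrr rnorm0 ltW.
  have e20 : 0 < e / 2 by rewrite divr_gt0.
  apply: filterS2 (elem x y _ e20) (IH _ e20) => i h1 h2.
  rewrite big_cons/= (linD Tl') (linD (TiP i).1.1) TE' (TiP i).2 opprD addrACA.
  by apply: le_trans (rnormD _ _) _; rewrite [leRHS]splitr lerD.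
apply/cvg_rnormP => e e0.
pose D := a * b + a * b + 1.
have D0 : 0 < D by rewrite ltr_wpDl// addr_ge0// mulr_ge0.
have d0 : 0 < e / D by rewrite divr_gt0.
have De : D * (e / D) = e by rewrite mulrC divfK// gt_eqF.
have [s [zs _]] := tensor_approx tP z d0.
apply: filterS (fin s _ d0) => i hi.
have [[Tl Tn] TE] := TiP i.
have -> : tensor_map A' B' z - tensor_map (A i) (B i) z =
   (tensor_map A' B' (z - tsum s) - tensor_map (A i) (B i) (z - tsum s)) +
   (tensor_map A' B' (tsum s) - tensor_map (A i) (B i) (tsum s)).
  by rewrite addrACA -opprD -(linD Tl') -(linD Tl) subrK.
apply: le_trans (rnormD _ _) _; apply: le_trans (lerD (rnormB _ _) hi) _.
have h1 := le_trans (Tn' _) (ler_wpM2l (mulr_ge0 a0 b0) zs).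
have h2 := le_trans (Tn _) (ler_wpM2l (mulr_ge0 a0 b0) zs).
apply: le_trans (lerD (lerD h1 h2) (lexx _)) _.
by move: De d0; rewrite /D; set d := e / _ => De d0; lra.
Qed.

End TensorMap.

(** A rank-one term [f x *: e] of [P x] contributes the operator that first maps
    [t x y] to [f x *: B y] in [Y] and then [y] to [t e y]; weak sequential
    completeness of [Y] applies in between. *)
Lemma finite_rank_tensor_weak (R : realType) (F : scalars)
    (X : normedModType (scalar_field R F))
    (Y Z : completeNormedModType (scalar_field R F)) (t : {bilinear X -> Y -> Z})
    (P : X -> X) (B : Y -> Y) a b (G : Z -> Z) M :
  is_projective_tensor_product t -> weakly_sequentially_complete Y ->
  0 <= a -> bounded_linear a P -> finite_rank P ->
  0 <= b -> bounded_linear b B ->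
  bounded_linear M G -> (forall x y, G (t x y) = t (P x) (B y)) ->
  forall u, weakly_cauchy u -> exists z, weakly_converges (fun n => G (u n)) z.
Proof.
move=> tP Yw a0 Pa Pf b0 Bb GM GE u uc; move: a a0 Pa G M GM GE.
have [tl tr tn] := tensor_bounded tP.
elim: P / Pf => [P P0|P P' N f e N0 fN _ IH PE] a a0 Pa G M GM GE.
  exists 0; have G0 z : G z = 0.
    apply: (tensor_ext tP (N := 0) (g := fun=> 0) GM) => [|x y].
      by split=> [c z' w|z']; rewrite ?scaler0 ?addr0// rnorm0 mul0r.
    by rewrite GE P0 (lin0 (tl _)).
  apply/weakly_convergesP => M' g gM d d0; exists 0 => n _.
  by rewrite G0 subrr rnorm0 ltW.
have Eb : bounded_bilinear (N * b) (fun x y => f x *: B y).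
  have [fl fn] := fN; have [Bl Bn] := Bb.
  split=> [y c x x'|x c y y'|x y].
  - by rewrite fl scalerDl scalerA.
  - by rewrite Bl scalerDr !scalerA mulrC.
  - by rewrite rnormZ mulrACA ler_pM ?rnorm_ge0.
have [E [EM EE]] := tensor_lift tP (mulr_ge0 N0 b0) Eb.
have te : bounded_linear (rnorm e) (t e).
  by split; [exact: tr|move=> y; have := tn e y; rewrite mul1r].
have teE := bounded_linear_comp (rnorm_ge0 e) te EM.
have [y0 Eu] := Yw _ (weakly_cauchy_map (mulr_ge0 N0 b0) EM uc).
have Eu' := weakly_converges_map (rnorm_ge0 e) te Eu.
have GEb := bounded_linearB GM teE.
have P'a : bounded_linear (a + N * rnorm e) P'.
  have [Pl Pn] := Pa; have [fl fn] := fN.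
  have P'E x : P' x = P x - f x *: e by rewrite PE addrK.
  split=> [c x y|x].
    rewrite !P'E Pl fl scalerDl scalerBr opprD addrACA; congr (_ + (_ + _)).
    by rewrite scalerA.
  rewrite P'E mulrDl; apply: le_trans (rnormB _ _) _; rewrite lerD//.
  by rewrite rnormZ mulrAC ler_wpM2r ?rnorm_ge0.
have [||z G'u] := IH (a + N * rnorm e) _ P'a _ _ GEb.
- by rewrite addr_ge0// mulr_ge0 ?rnorm_ge0.
- move=> x y; rewrite GE EE PE (linD (tl _)) (linZ (tl _)) (linZ (tr _)).
  by rewrite addrK.
exists (z + t e y0).
have -> : (fun n => G (u n)) = (fun n => (G (u n) - t e (E (u n))) + t e (E (u n))).
  by apply/funext => n; rewrite subrK.
exact: weakly_convergesD.
Qed.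

(** * Symmetry of the projective tensor product *)

Section Swap.
Variables (R : realType) (F : scalars).
Local Notation K := (scalar_field R F).
Implicit Types X Y : normedModType K.

Definition swap_seq (X Y : Type) (s : seq (X * Y)) : seq (Y * X) :=
  [seq (z.2, z.1) | z <- s].

Lemma swap_seqK (X Y : Type) : cancel (@swap_seq X Y) (@swap_seq Y X).
Proof. by elim=> [|[x y] s IH] //; rewrite /= IH. Qed.

Lemma same_tensor_swap X Y (s s' : seq (X * Y)) :
  same_tensor s s' -> same_tensor (swap_seq s) (swap_seq s').
Proof.
move=> ss b; have [bl br] : (forall x, linear (b^~ x)) /\ (forall y, linear (b y)).
  by split=> [x a y y'|y a x x']; rewrite ?linearPl ?linearPr.
have [g gE] := exists_bilinear (b := fun x y => b y x) br bl.
have bE r : \sum_(z <- swap_seq r) b z.1 z.2 = \sum_(z <- r) g z.1 z.2.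
  by rewrite big_map; apply: eq_bigr => z _; rewrite gE.
by rewrite !bE; exact: ss.
Qed.

Lemma projective_norm_swap X Y (s : seq (X * Y)) :
  projective_norm (swap_seq s) = projective_norm s.
Proof.
suff cost_sub (X' Y' : normedModType K) (r : seq (X' * Y')) :
    [set \sum_(z <- r') rnorm z.1 * rnorm z.2 | r' in same_tensor r] `<=`
    [set \sum_(z <- r') rnorm z.1 * rnorm z.2 | r' in same_tensor (swap_seq r)].
  congr inf; apply/seteqP; split; last exact: cost_sub.
  by have := cost_sub _ _ (swap_seq s); rewrite swap_seqK.
move=> _ [r' rr' <-]; exists (swap_seq r'); first exact: same_tensor_swap.
by rewrite big_map; apply: eq_bigr => z _; rewrite mulrC.
Qed.

(** By symmetry, what is proved for finite rank in the first factor holds for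
    the second one. *)
Lemma projective_tensor_product_swap X Y (Z : completeNormedModType K)
    (t : {bilinear X -> Y -> Z}) : is_projective_tensor_product t ->
  exists t' : {bilinear Y -> X -> Z},
    is_projective_tensor_product t' /\ forall x y, t' y x = t x y.
Proof.
move=> tP; have [tl tr _] := tensor_bounded tP.
have [t' tE] := exists_bilinear (b := fun y x => t x y) tr tl.
have sumE s : \sum_(z <- s) t' z.1 z.2 = \sum_(z <- swap_seq s) t z.1 z.2.
  by rewrite big_map; apply: eq_bigr => z _; rewrite tE.
exists t'; split=> [|x y]; last exact: tE.
split=> [s|]; first by rewrite sumE tP.1 projective_norm_swap.
move=> O O0 oO; have [w [Ow [s _ sw]]] := tP.2 _ O0 oO.
exists w; split=> //; exists (swap_seq s) => //.
by rewrite sumE swap_seqK.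
Qed.

End Swap.

(** * Unconditional decompositions and Hoelder's inequality *)

Section Decomposition.
Variables (R : realType) (F : scalars).
Local Notation K := (scalar_field R F).
Variables (V : normedModType K) (I : choiceType) (Vs : I -> set V) (p : R).
Hypothesis VsP : unconditional_fdd Vs.
Hypothesis p_gt1 : 1 < p.
Hypothesis Vs_lower : disjoint_lower_estimate Vs p.

Lemma decomp_projP x : expansion Vs x (fun i => decomp_proj Vs i x).
Proof.
have [v [vP _]] := VsP.1.2 x.
suff -> : (fun i => decomp_proj Vs i x) = xget (fun=> 0) [set v | expansion Vs x v].
  by apply: xgetPex; exists v.
by apply/funext.
Qed.

Lemma decomp_proj_unique x v : expansion Vs x v -> forall i, decomp_proj Vs i x = v i.
Proof.
move=> vP i; have [w [_ wU]] := VsP.1.2 x.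
by rewrite -(wU _ vP) (wU _ (decomp_projP x)).
Qed.

Lemma decomp_proj_linear i : linear (decomp_proj Vs i).
Proof.
move=> a x y.
apply: (@decomp_proj_unique (a *: x + y)
  (fun j => a *: decomp_proj Vs j x + decomp_proj Vs j y)).
have [xV xs] := decomp_projP x; have [yV ys] := decomp_projP y.
split=> [j|].
  have [_ /(_ a)] := (VsP.1.1 j).2.
  by move=> h; apply/set_mem/h; apply/mem_set.
rewrite /unconditional_sum.
under eq_fun do rewrite big_split/= -scaler_sumr.
by apply: cvgD ys; exact: cvgZl_tmp.
Qed.

Lemma decomp_fproj_linear C : linear (decomp_fproj Vs C).
Proof.
move=> a x y; rewrite /decomp_fproj scaler_sumr -big_split/=.
by apply: eq_bigr => i _; exact: decomp_proj_linear.
Qed.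

Lemma decomp_fproj_cvg x : decomp_fproj Vs C x @[C --> totally] --> x.
Proof. exact: (decomp_projP x).2. Qed.

Lemma decomp_fprojD C C' x : (C `<=` C')%fset ->
  decomp_fproj Vs (C' `\` C)%fset x = decomp_fproj Vs C' x - decomp_fproj Vs C x.
Proof.
move=> CC'; apply/eqP; rewrite eq_sym subr_eq; apply/eqP.
rewrite /decomp_fproj (big_fsetID _ [in C] C')/= addrC; congr (_ + _).
  by apply: eq_fbigl => i; rewrite !inE andbC.
apply: eq_fbigl => i; rewrite !inE; apply/andP/idP => [[]//|iC].
by split=> //; exact: (fsubsetP CC').
Qed.

(** The lower estimate for a single set bounds the projections uniformly. *)
Lemma decomp_fproj_bounded : exists2 c : R, 0 <= c &
  forall C, bounded_linear c (decomp_fproj Vs C).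
Proof.
have [c c0 hc] := Vs_lower; exists c; first exact: ltW.
move=> C; split; first exact: decomp_fproj_linear.
move=> x; have := hc 1%N (fun=> C) _ x; rewrite big_ord1 -powRrM divff.
  by rewrite powRr1 ?rnorm_ge0//; apply=> i j; rewrite !ord1.
by rewrite gt_eqF// (lt_trans ltr01).
Qed.

Lemma finite_rank_decomp_fproj C : finite_rank (decomp_fproj Vs C).
Proof.
have [c c0 hc] := decomp_fproj_bounded.
have fr i : finite_rank (decomp_proj Vs i).
  have [n [e he]] := VsP.2 i.
  apply: (@finite_rank_span _ _ _ _ c _ n e) => //.
    have -> : decomp_proj Vs i = decomp_fproj Vs [fset i]%fset; last exact: hc.
    by apply/funext => x; rewrite /decomp_fproj big_seq_fset1.
  move=> x; have [xV _] := decomp_projP x.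
  by have [a _ <-] := he _ (xV i); exists a.
rewrite /decomp_fproj; elim: (enum_fset C) => [|i s IH].
  by apply: finite_rank0 => x; rewrite big_nil.
rewrite (_ : (fun x => _) =
  (fun x => decomp_proj Vs i x + \sum_(j <- s) decomp_proj Vs j x)).
  exact: finite_rank_add.
by apply/funext => x; rewrite big_cons.
Qed.

End Decomposition.

Section Hoelder.
Variable R : realType.

(** A substitute for Young's inequality. If [a `^ p <= b `^ q], then
    [a <= b `^ (q / p)], so [a * b <= b `^ (q / p + 1)], and the exponent is at
    least [q] exactly when [1 <= p^-1 + q^-1]. *)
Lemma mul_le_powRD (a b p q : R) : 1 < p -> 1 < q -> 1 <= p^-1 + q^-1 ->
  0 <= a <= 1 -> 0 <= b <= 1 -> a * b <= a `^ p + b `^ q.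
Proof.
wlog ab : a b p q / a `^ p <= b `^ q.
  move=> wl p1 q1 pq a1 b1; have [ab|/ltW ba] := leP (a `^ p) (b `^ q); first exact: wl.
  by rewrite mulrC addrC; apply: wl => //; rewrite addrC.
move=> p1 q1 pq /andP[a0 a1] /andP[b0 b1].
have p0 : 0 < p by apply: lt_trans p1.
have q0 : 0 < q by apply: lt_trans q1.
suff h : a * b <= b `^ q by rewrite (le_trans h)// lerDr powR_ge0.
move: b0; rewrite le_eqVlt => /predU1P[<-|b0]; first by rewrite mulr0 powR_ge0.
have -> : a = (a `^ p) `^ p^-1 by rewrite -powRrM divff ?gt_eqF// powRr1.
apply: le_trans (_ : (b `^ q) `^ p^-1 * b <= _).
  apply: ler_wpM2r; first exact: ltW.
  by apply: ge0_ler_powR; rewrite ?nnegrE ?powR_ge0 ?invr_ge0 ?(ltW p0).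
rewrite -powRrM -[X in _ * X](powRr1 (ltW b0)) -powRD; last first.
  by rewrite (gt_eqF b0) implybT.
apply: ger_powR; first by rewrite b0.
have : q * 1 <= q * (p^-1 + q^-1) by rewrite ler_pM2l.
by rewrite mulr1 mulrDr divff ?gt_eqF.
Qed.

Lemma sum_mul_le (a b : nat -> R) n p q A B :
  1 < p -> 1 < q -> 1 <= p^-1 + q^-1 ->
  (forall k, 0 <= a k) -> (forall k, 0 <= b k) -> 0 < A -> 0 < B ->
  (\sum_(0 <= k < n) a k `^ p) `^ p^-1 <= A ->
  (\sum_(0 <= k < n) b k `^ q) `^ q^-1 <= B ->
  \sum_(0 <= k < n) a k * b k <= 2 * (A * B).
Proof.
move=> p1 q1 pq a0 b0 A0 B0 hA hB.
have norm1 (c : nat -> R) r C : 1 < r -> (forall k, 0 <= c k) -> 0 < C ->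
    (\sum_(0 <= k < n) c k `^ r) `^ r^-1 <= C ->
    (forall k, (k < n)%N -> 0 <= c k / C <= 1) /\
    \sum_(0 <= k < n) (c k / C) `^ r <= 1.
  move=> r1 c0 C0 hC; have r0 : 0 < r by apply: lt_trans r1.
  have sum1 : \sum_(0 <= k < n) (c k / C) `^ r <= 1.
    under eq_bigr => k _ do rewrite powRM ?c0 ?invr_ge0 ?(ltW C0)//.
    rewrite -mulr_suml -powR_inv1 ?(ltW C0)// powRAC powR_inv1 ?powR_ge0//.
    rewrite ler_pdivrMr ?powR_gt0// mul1r.
    set S := \sum_(_ <= _ < _) _ in hC *.
    have S0 : 0 <= S by apply: sumr_ge0 => k _; exact: powR_ge0.
    rewrite -[leLHS]powRr1// -[X in S `^ X](mulVf (_ : r != 0)) ?gt_eqF// powRrM.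
    by apply: ge0_ler_powR; rewrite ?nnegrE ?powR_ge0 ?(ltW r0) ?(ltW C0).
  split=> // k kn; rewrite divr_ge0 ?(ltW C0)//=.
  have ck : (c k / C) `^ r <= 1.
    apply: le_trans sum1; rewrite big_mkord (bigD1 (Ordinal kn))//= lerDl.
    by apply: sumr_ge0 => i _; exact: powR_ge0.
  rewrite leNgt; apply/negP => h.
  have := gt0_ltr_powR r0 (_ : 1 \in Num.nneg) (_ : c k / C \in Num.nneg) h.
  by rewrite !nnegrE ler01 divr_ge0 ?(ltW C0)// powR1 ltNge ck => /(_ isT isT).
have [a1 sa] := norm1 _ _ _ p1 a0 A0 hA; have [b1 sb] := norm1 _ _ _ q1 b0 B0 hB.
have -> : \sum_(0 <= k < n) a k * b k =
    (\sum_(0 <= k < n) (a k / A) * (b k / B)) * (A * B).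
  rewrite mulr_suml; apply: eq_bigr => k _.
  by rewrite mulrACA divfK ?gt_eqF// divfK ?gt_eqF.
rewrite ler_pM2r ?mulr_gt0//.
apply: le_trans (_ : \sum_(0 <= k < n) ((a k / A) `^ p + (b k / B) `^ q) <= _).
  by apply: ler_sum_nat => k /andP[_ kn]; apply: mul_le_powRD; [..|exact: a1|exact: b1].
by rewrite big_split/= -[2]/(1 + 1) lerD.
Qed.

End Hoelder.

(** * Corners and blocks *)

Lemma totally_ge (I : choiceType) (C : {fset I}) :
  \forall S \near totally, (C `<=` S)%fset.
Proof. by exists C. Qed.

Section Corner.
Variables (R : realType) (F : scalars) (p q : R).
Local Notation K := (scalar_field R F).
Variables (X Y Z : completeNormedModType K) (I J : choiceType).
Variables (Xs : I -> set X) (Ys : J -> set Y) (t : {bilinear X -> Y -> Z}).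
Hypotheses (p_gt1 : 1 < p) (q_gt1 : 1 < q) (pq_ge1 : 1 <= p^-1 + q^-1).
Hypotheses (XsP : unconditional_fdd Xs) (YsP : unconditional_fdd Ys).
Hypothesis Xs_lower : disjoint_lower_estimate Xs p.
Hypothesis Ys_lower : disjoint_lower_estimate Ys q.
Hypothesis tP : is_projective_tensor_product t.

Local Notation PX := (decomp_fproj Xs).
Local Notation PY := (decomp_fproj Ys).

(** The norms of the blocks of [x] form a vector of l^p norm at most [c * |x|],
    those of [y] one of l^q norm at most [d * |y|]. The condition on the
    exponents embeds l^q into the dual of l^p, so the two can be paired. *)
Lemma disjoint_blocks_sum_le : exists2 M : R, 0 <= M &
  forall (A : nat -> {fset I}) (B : nat -> {fset J}),
    (forall k l, k != l -> [disjoint A k & A l]%fset) ->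
    (forall k l, k != l -> [disjoint B k & B l]%fset) ->
  forall n x y, \sum_(0 <= k < n) rnorm (PX (A k) x) * rnorm (PY (B k) y) <=
    M * (rnorm x * rnorm y).
Proof.
have [c c0 hc] := Xs_lower; have [d d0 hd] := Ys_lower.
exists (2 * (c * d)) => [|A B Adisj Bdisj n x y].
  by rewrite !mulr_ge0// ltW.
have [->|x0] := eqVneq x 0.
  rewrite rnorm0 mul0r mulr0 big1// => k _.
  by rewrite (lin0 (decomp_fproj_linear XsP _)) rnorm0 mul0r.
have [->|y0] := eqVneq y 0.
  rewrite rnorm0 !mulr0 big1// => k _.
  by rewrite (lin0 (decomp_fproj_linear YsP _)) rnorm0 mulr0.
have pos (V : normedModType K) (v : V) : v != 0 -> 0 < rnorm v.
  move=> v0; rewrite lt_neqAle rnorm_ge0 andbT eq_sym.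
  by apply: contraNneq v0 => /rnorm0_eq0 ->.
rewrite -mulrA mulrACA.
apply: (sum_mul_le p_gt1 q_gt1 pq_ge1).
- by move=> k; exact: rnorm_ge0.
- by move=> k; exact: rnorm_ge0.
- by rewrite mulr_gt0// pos.
- by rewrite mulr_gt0// pos.
- by rewrite big_mkord; apply: hc => k l kl; exact: Adisj.
- by rewrite big_mkord; apply: hd => k l kl; exact: Bdisj.
Qed.

(** The operator (1 - P_C) (x) (1 - Q_D). *)
Definition corner C D : Z -> Z :=
  tensor_map t (fun x => x - PX C x) (fun y => y - PY D y).

(** A block is a truncation of the corner at [C] and [D] by larger sets. *)
Definition block C D C' D' : Z -> Z :=
  tensor_map t (PX (C' `\` C)%fset) (PY (D' `\` D)%fset).

Lemma block_cvg_corner C D z (e : R) : 0 < e -> exists C' D',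
  [/\ (C `<=` C')%fset, (D `<=` D')%fset &
      rnorm (corner C D z - block C D C' D' z) <= e].
Proof.
move=> e0; have [c c0 hc] := decomp_fproj_bounded XsP p_gt1 Xs_lower.
have [d d0 hd] := decomp_fproj_bounded YsP q_gt1 Ys_lower.
pose G : set_system ({fset I} * {fset J}) := filter_prod totally totally.
have FG : ProperFilter G by exact: filter_prod_proper.
have cf (V : normedModType K) (H : choiceType) (Vs : H -> set V) S (x : V) :
    unconditional_fdd Vs ->
    decomp_fproj Vs (S' `\` S)%fset x @[S' --> totally] --> x - decomp_fproj Vs S x.
  move=> VsP; apply: cvg_trans
    (_ : decomp_fproj Vs S' x - decomp_fproj Vs S x @[S' --> totally] `=>` _).
    apply: near_eq_cvg; exists S => // S' /= SS'.
    by rewrite decomp_fprojD.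
  apply: cvgB; last exact: cvg_cst.
  exact: decomp_fproj_cvg.
have bX : bounded_linear (1 + c) (fun x => x - PX C x).
  exact: bounded_linearB (bounded_linear_id _) (hc C).
have bY : bounded_linear (1 + d) (fun y => y - PY D y).
  exact: bounded_linearB (bounded_linear_id _) (hd D).
have cX x : PX (i.1 `\` C)%fset x @[i --> G] --> x - PX C x.
  apply: (cvg_comp fst (fun S' => PX (S' `\` C)%fset x) cvg_fst).
  exact: cf.
have cY y : PY (i.2 `\` D)%fset y @[i --> G] --> y - PY D y.
  apply: (cvg_comp snd (fun S' => PY (S' `\` D)%fset y) cvg_snd).
  exact: cf.
have leX S : bounded_linear (1 + c) (PX S).
  by apply: bounded_linearW (hc S); rewrite lerDr.
have leY S : bounded_linear (1 + d) (PY S).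
  by apply: bounded_linearW (hd S); rewrite lerDr.
have := tensor_map_cvg tP (FG : Filter G) (addr_ge0 ler01 c0) (addr_ge0 ler01 d0)
  (fun i => leX _) (fun i => leY _) bX bY cX cY (z := z).
move=> /cvg_rnormP/(_ _ e0) close.
have CG : \forall i \near G, (C `<=` i.1)%fset by exact: (cvg_fst (@totally_ge I C)).
have DG : \forall i \near G, (D `<=` i.2)%fset by exact: (cvg_snd (@totally_ge J D)).
have [[C' D'] [[/= CC' DD'] h]] := filter_ex (filterI (filterI CG DG) close).
by exists C', D'.
Qed.

(** Otherwise every corner is large on some [u n] with [n] as large as desired,
    and so is a block that approximates it. Repeating this beyond the sets
    already used yields disjoint blocks, which contradicts [l1_schur]. *)
Lemma corner_small (u : nat -> Z) (e : R) : weakly_cauchy u -> 0 < e ->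
  exists C D N, forall n, (N <= n)%N -> rnorm (corner C D (u n)) <= e.
Proof.
move=> uc e0; apply: contrapT => H.
have big (s : nat * ({fset I} * {fset J})) : exists r : nat * ({fset I} * {fset J}),
    [/\ (s.1 <= r.1)%N, (s.2.1 `<=` r.2.1)%fset, (s.2.2 `<=` r.2.2)%fset &
      e < rnorm (block s.2.1 s.2.2 r.2.1 r.2.2 (u r.1))].
  case: s => N [C D] /=.
  have [n [Nn en]] : exists n, (N <= n)%N /\ e < rnorm (corner C D (u n)).
    apply: contrapT => h; apply: H; exists C, D, N => n Nn.
    by rewrite leNgt; apply/negP => en; apply: h; exists n.
  have gap : 0 < (rnorm (corner C D (u n)) - e) / 2 by rewrite divr_gt0// subr_gt0.
  have [C' [D' [CC' DD' h]]] := block_cvg_corner C D (u n) gap.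
  exists (n, (C', D')); split=> //=.
  have := rnormD (corner C D (u n) - block C D C' D' (u n)) (block C D C' D' (u n)).
  by rewrite subrK; lra.
have {big} [next hnext] := choice big.
(* The first component of a state is a lower bound for the index of the next
   term; keeping it above [k] forces [k <= n k]. *)
pose s := fix s k := if k is k'.+1 then let r := next (s k') in (maxn k r.1, r.2)
  else (0%N, (fset0, fset0)).
pose n k := (next (s k)).1.
have sE k : (s k.+1).2 = (next (s k)).2 by [].
have sk k : (k <= (s k).1)%N by case: k => [|k]; rewrite //= leq_maxl.
have kn k : (k <= n k)%N by have [h _ _ _] := hnext (s k); exact: leq_trans h.
pose A k := ((s k.+1).2.1 `\` (s k).2.1)%fset.
pose B k := ((s k.+1).2.2 `\` (s k).2.2)%fset.
have subX k l : (k <= l)%N -> ((s k).2.1 `<=` (s l).2.1)%fset.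
  move=> /subnKC <-; elim: (l - k)%N => [|i IH]; first by rewrite addn0.
  by rewrite addnS; have [_ h _ _] := hnext (s (k + i)%N); exact: fsubset_trans IH h.
have subY k l : (k <= l)%N -> ((s k).2.2 `<=` (s l).2.2)%fset.
  move=> /subnKC <-; elim: (l - k)%N => [|i IH]; first by rewrite addn0.
  by rewrite addnS; have [_ _ h _] := hnext (s (k + i)%N); exact: fsubset_trans IH h.
have disj (H' : choiceType) (S : nat -> {fset H'}) :
    (forall k l, (k <= l)%N -> (S k `<=` S l)%fset) ->
    forall k l, k != l -> [disjoint S k.+1 `\` S k & S l.+1 `\` S l]%fset.
  move=> Sinc k l kl; wlog {kl} kl : k l / (k < l)%N.
    move=> wl; have [/wl//|lk|kl'] := ltngtP k l; last by rewrite kl' eqxx in kl.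
    by rewrite fdisjoint_sym; exact: wl.
  apply/fdisjointP => i; rewrite !inE => /andP[_ ik].
  by rewrite (fsubsetP (Sinc _ _ kl) _ ik).
have [c c0 hc] := decomp_fproj_bounded XsP p_gt1 Xs_lower.
have [d d0 hd] := decomp_fproj_bounded YsP q_gt1 Ys_lower.
have [M M0 hM] := disjoint_blocks_sum_le.
have hAB := hM A B (disj _ _ subX) (disj _ _ subY).
pose T k := tensor_map t (PX (A k)) (PY (B k)).
have Tl k : linear (T k) by exact: (tensor_mapP tP c0 d0 (hc _) (hd _)).1.1.
have TM m z : \sum_(0 <= k < m) rnorm (T k z) <= M * rnorm z.
  exact: (tensor_map_l1 tP c0 d0 M0 (fun k => hc _) (fun k => hd _) (hAB m)).
have [N hN] := l1_schur Tl TM uc e0.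
have := hN N (n N) (leqnn _) (kn N).
by have [_ _ _] := hnext (s N); rewrite ltNge => /negP.
Qed.

Lemma corner_complement C D z :
  z - corner C D z =
    tensor_map t (PX C) id z + tensor_map t (fun x => x - PX C x) (PY D) z.
Proof.
have [c c0 hc] := decomp_fproj_bounded XsP p_gt1 Xs_lower.
have [d d0 hd] := decomp_fproj_bounded YsP q_gt1 Ys_lower.
have [tl tr _] := tensor_bounded tP.
have c10 := addr_ge0 ler01 c0; have d10 := addr_ge0 ler01 d0.
have bX := bounded_linearB (bounded_linear_id X) (hc C).
have bY := bounded_linearB (bounded_linear_id Y) (hd D).
have [T0 T0E] := tensor_mapP tP c10 d10 bX bY.
have [T1 T1E] := tensor_mapP tP c0 ler01 (hc C) (bounded_linear_id Y).
have [T2 T2E] := tensor_mapP tP c10 d0 bX (hd D).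
apply: (tensor_ext tP (bounded_linearB (bounded_linear_id Z) T0)
  (bounded_linearD T1 T2)).
move=> x y; rewrite T0E T1E T2E (linB (tr _)) opprB addrCA addrC.
by congr (_ + _); rewrite (linB (tl _)) subKr.
Qed.

End Corner.

Theorem theorem3p14 (R : realType) (F : scalars) (p q : R)
    (X Y : completeNormedModType (scalar_field R F)) (I J : choiceType)
    (Xs : I -> set X) (Ys : J -> set Y)
    (Z : completeNormedModType (scalar_field R F))
    (t : {bilinear X -> Y -> Z})
    (p_gt1 : 1 < p) (q_gt1 : 1 < q) (pq_ge1 : 1 <= p^-1 + q^-1)
    (XsP : unconditional_fdd Xs) (YsP : unconditional_fdd Ys)
    (Xs_lower : disjoint_lower_estimate Xs p)
    (Ys_lower : disjoint_lower_estimate Ys q)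
    (X_wsc : weakly_sequentially_complete X)
    (Y_wsc : weakly_sequentially_complete Y)
    (ZP : is_projective_tensor_product t) :
  weakly_sequentially_complete Z.
Proof.
move=> u uc; apply: weakly_converges_approx => e e0.
have [C [D [N hN]]] :=
  corner_small p_gt1 q_gt1 pq_ge1 XsP YsP Xs_lower Ys_lower ZP uc e0.
have [c c0 hc] := decomp_fproj_bounded XsP p_gt1 Xs_lower.
have [d d0 hd] := decomp_fproj_bounded YsP q_gt1 Ys_lower.
have idX := bounded_linear_id X; have idY := bounded_linear_id Y.
have c10 := addr_ge0 ler01 c0.
have bX := bounded_linearB idX (hc C).
(* The complement of the corner, term by term; the second term has finite rank
   in the factor [Y], so it is treated in the swapped tensor product. *)
have [T1 T1E] := tensor_mapP ZP c0 ler01 (hc C) idY.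
have [T2 T2E] := tensor_mapP ZP c10 d0 bX (hd D).
have frX := finite_rank_decomp_fproj XsP p_gt1 Xs_lower C.
have frY := finite_rank_decomp_fproj YsP q_gt1 Ys_lower D.
have [z1 uz1] := finite_rank_tensor_weak ZP Y_wsc c0 (hc C) frX ler01 idY T1 T1E uc.
have [t' [tP' t'E]] := projective_tensor_product_swap ZP.
have T2E' y x :
    tensor_map t (fun x => x - decomp_fproj Xs C x) (decomp_fproj Ys D) (t' y x) =
    t' (decomp_fproj Ys D y) (x - decomp_fproj Xs C x) by rewrite !t'E T2E.
have [z2 uz2] := finite_rank_tensor_weak tP' X_wsc d0 (hd D) frY c10 bX T2 T2E' uc.
have uz := weakly_convergesD uz1 uz2.
eexists _, _, N; split; first exact: uz.
move=> n Nn /=; rewrite -(corner_complement p_gt1 q_gt1 XsP YsP Xs_lower Ys_lower ZP).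
by rewrite opprB addrC subrK hN.
Qed.
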